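(* Let $m,n\ge 2$ and $1\le p\le\infty$. Let $c_p^{\mathrm{sym}}(m,n)$ be the smallest constant such that $$\Bigl\| \Bigl|\sum_{k=1}^m A_k\Bigr|_{\mathrm{sym}} \Bigr\|_p\ \le\ c_p^{\mathrm{sym}}(m,n)\,\Bigl\| \sum_{k=1}^m |A_k|_{\mathrm{sym}} \Bigr\|_p\qquad\text{for all }A_1,\dots,A_m\in\mathbb{M}_n.$$ Then the following statements hold: (1) $c_1^{\mathrm{sym}}(m,n)=1$; (2) $c_\infty^{\mathrm{sym}}(m,n)=\sqrt2$ for $n\ge 3$; (3) $c_p^{\mathrm{sym}}(m,n)\le \min\{2^{1-\frac1p},\sqrt2\}$; (4) $c_p^{\mathrm{sym}}(m,n)\ge \left(\frac{2^{\frac p2}+2^{1-\frac p2}}{3}\right)^{\frac1p}$; in particular, the right-hand side increases from $1$ at $p=2$ to $\sqrt2$ as $p\to\infty$.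
   Context: $\mathbb{M}_n$ is the set of $n\times n$ complex matrices, $Z^*$ is the conjugate transpose of $Z$, $|Z|:=(Z^*Z)^{1/2}$, and the arithmetic symmetric modulus is $|Z|_{\mathrm{sym}}:=\frac{|Z|+|Z^*|}{2}$. For $1\le p<\infty$, the Schatten $p$-norm is $\|X\|_p:=(\operatorname{Tr}|X|^p)^{1/p}$; $\|X\|_\infty$ is the operator norm (largest singular value), and $\frac1\infty=0$. For $p=\infty$ the right-hand side in (4) is read as its limit $\sqrt2$.
   Formalization: The lower bound (4) is stated for n ≥ 3 with all p, and for n = 2 only when p ≤ 2; as printed it is false for n = 2 at p = ∞ (there the constant is at most 5/4 < √2) and for large finite p. *)

(* Defs.v *)
From HB Require Import structures.
From mathcomp Require Import all_boot all_order all_algebra.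
From mathcomp Require Import spectral.
From mathcomp Require Export complex.
From mathcomp Require Import all_classical all_reals all_analysis.

Set Implicit Arguments.
Unset Strict Implicit.
Unset Printing Implicit Defensive.

Import Order.TTheory GRing.Theory Num.Theory.
Import numFieldNormedType.Exports.

Local Open Scope classical_set_scope.
Local Open Scope ring_scope.
Local Open Scope complex_scope.
Local Open Scope sesquilinear_scope.

(* Spectral functional calculus.  It is meaningful for normal [A] (only
   positive semidefinite [A] occur below), for which
   [A = invmx U *m diag_mx d *m U] with [U := spectralmx A] unitary and
   [d := spectral_diag A] the eigenvalues of [A]. *)
Definition mxfun (R : realType) (n : nat) (f : R[i] -> R[i]) (A : 'M[R[i]]_n) :
    'M[R[i]]_n :=
  invmx (spectralmx A) *m diag_mx (map_mx f (spectral_diag A)) *m spectralmx A.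

Definition absmx (R : realType) (n : nat) (Z : 'M[R[i]]_n) : 'M[R[i]]_n :=
  mxfun sqrtC (Z ^t* *m Z).

Definition symabsmx (R : realType) (n : nat) (Z : 'M[R[i]]_n) : 'M[R[i]]_n :=
  2^-1 *: (absmx Z + absmx (Z ^t*)).

(* Real power of a positive semidefinite matrix; taking real parts loses
   nothing since the eigenvalues are then real. *)
Definition psd_powR (R : realType) (n : nat) (A : 'M[R[i]]_n) (r : R) :
    'M[R[i]]_n :=
  mxfun (fun z => (complex.Re z `^ r)%:C) A.

(* The singular values of [X] are the eigenvalues of [absmx X]. *)
Definition opnorm (R : realType) (n : nat) (X : 'M[R[i]]_n) : R :=
  \big[Num.max/0]_(i < n) complex.Re (spectral_diag (absmx X) 0 i).

(* Used for [1 <= p <= +oo] only; the value at [-oo] is junk. *)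
Definition schatten_norm (R : realType) (n : nat) (p : \bar R)
    (X : 'M[R[i]]_n) : R :=
  match p with
  | r%:E => complex.Re (\tr (psd_powR (absmx X) r)) `^ r^-1
  | +oo%E => opnorm X
  | -oo%E => 0
  end.

Definition sym_bound (R : realType) (p : \bar R) (m n : nat) (c : R) : Prop :=
  forall A : 'I_m -> 'M[R[i]]_n,
    schatten_norm p (symabsmx (\sum_(k < m) A k))
    <= c * schatten_norm p (\sum_(k < m) symabsmx (A k)).

(* As an [inf] in [R] this is only the greatest lower bound of the admissible
   constants; that it is the smallest admissible constant has to be proved. *)
Definition csym (R : realType) (p : \bar R) (m n : nat) : R :=
  inf [set c : R | sym_bound p m n c].

Definition csym_lower (R : realType) (p : \bar R) : R :=
  if p is r%:E then ((2 `^ (r / 2) + 2 `^ (1 - r / 2)) / 3) `^ r^-1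
  else Num.sqrt 2.

(* Main.v *)
Require Import Defs.
From HB Require Import structures.
From mathcomp Require Import all_boot all_order all_algebra.
From mathcomp Require Import spectral.
From mathcomp Require Import all_classical all_reals all_analysis.
From mathcomp Require Import ring lra.
Set Implicit Arguments.
Unset Strict Implicit.
Unset Printing Implicit Defensive.
Import Order.TTheory GRing.Theory Num.Theory.
Import numFieldNormedType.Exports.
Local Open Scope classical_set_scope.
Local Open Scope ring_scope.
Local Open Scope complex_scope.
Local Open Scope sesquilinear_scope.

(** Let P = sum_k |A_k|, Q = sum_k |A_k^*|, M = (P + Q) / 2, A = sum_k A_k, so
    that |A|_sym has to be compared with M = sum_k |A_k|_sym.  The singular value
    decomposition of each A_k gives
      2 |x A_k y^*| <= x |A_k^*| x^* + y |A_k| y^*,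
    and summing over k shows that A is dominated by the pair (Q, P).  This is the
    only property of the family that the two upper bounds use.  For finite p both
    rest on the Peierls inequality (lemma peierls): for p >= 1, the diagonal
    entries of a positive matrix in an orthonormal basis have at most the l^p
    norm of its eigenvalues; for p = +oo, on the same fact for the maximum.

    The constant 2^(1 - 1/p).  If u_j, v_j are singular vectors of A, then
    s_j = u_j A v_j^* is at most the mean of u_j Q u_j^* and v_j P v_j^*, whence
    Tr |A|^p <= (Tr Q^p + Tr P^p) / 2.  Since Tr Q^p + Tr P^p <= Tr (Q + P)^p
    (tpow_superadd), this is at most Tr (2 M)^p / 2.  The same bound for A^* and
    convexity of the p-th power pass it on to |A|_sym.

    The constant sqrt 2.  Let A = H + i K with H, K Hermitian.  Operator
    convexity of the square gives 2 |A|_sym^2 <= A^* A + A A^* = 2 (H^2 + K^2),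
    and domination gives -M <= H <= M and -M <= K <= M, so that the Schatten norms
    of H and K are at most that of M.  For p >= 2 the triangle inequality for the
    exponent p/2 yields the square of the norm of |A|_sym at most twice that of
    M; for p <= 2 the first constant is the smaller one.

    For n >= 3 the lower bound is the ratio attained by an explicit pair of
    rank-one matrices (extremal_pair); for p <= 2 it is at most 1, which the
    identity matrix attains.  It increases with p because it is the L^p norm of a
    fixed function on a probability space. *)

(** * Scalar inequalities for real powers *)

(** Young's inequality for the exponents p / (p - 1) and p: the graph of the p-th
    power lies above its tangent at x. *)
Lemma powR_tangent (R : realType) (p x y : R) : 1 <= p -> 0 <= x -> 0 <= y ->
  p * x `^ (p - 1) * y <= (p - 1) * x `^ p + y `^ p.
Proof.
move=> p1 x0 y0; have p0 : 0 < p by lra.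
have [->|pN1] := eqVneq p 1.
  by rewrite subrr powRr0 !powRr1 // mul0r add0r !mul1r.
have {pN1} p1' : 1 < p by rewrite lt_neqAle eq_sym pN1.
have pB0 : 0 < p - 1 by lra.
have := @conjugate_powR R (x `^ (p - 1)) y (p / (p - 1)) p (powR_ge0 _ _) y0.
rewrite divr_gt0 // => /(_ isT p0).
have -> : (p / (p - 1))^-1 + p^-1 = 1 by field; lra.
move=> /(_ erefl).
rewrite -powRrM.
have -> : (p - 1) * (p / (p - 1)) = p by field; lra.
move=> /(ler_wpM2l (ltW p0)).
congr (_ <= _); first by rewrite mulrA.
field; lra.
Qed.

(** Average the tangents at q = sum_j w_j d_j; the weights need not sum to 1
    since the p-th power vanishes at 0. *)
Lemma powR_jensen (R : realType) (n : nat) (p : R) (w d : 'I_n -> R) :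
  1 <= p -> (forall j, 0 <= w j) -> (forall j, 0 <= d j) ->
  \sum_j w j <= 1 ->
  (\sum_j w j * d j) `^ p <= \sum_j w j * d j `^ p.
Proof.
move=> p1 w0 d0 w1; set q := \sum_j w j * d j.
have p0 : 0 < p by lra.
have q0 : 0 <= q by apply: sumr_ge0 => j _; rewrite mulr_ge0.
have : \sum_j w j * (p * q `^ (p - 1) * d j - (p - 1) * q `^ p)
       <= \sum_j w j * d j `^ p.
  apply: ler_sum => j _; apply: ler_wpM2l => //.
  have := powR_tangent p1 q0 (d0 j); lra.
apply: le_trans.
under eq_bigr do rewrite mulrBr mulrCA.
rewrite sumrB -mulr_sumr -mulr_suml -/q -mulrA [_ * q]mulrC mulr_powRB1 //.
have : (\sum_j w j) * ((p - 1) * q `^ p) <= 1 * ((p - 1) * q `^ p).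
  by apply: ler_wpM2r => //; rewrite mulr_ge0 ?powR_ge0 //; lra.
lra.
Qed.

Lemma powR_midpoint (R : realType) (p a b : R) : 1 <= p -> 0 <= a -> 0 <= b ->
  (2^-1 * (a + b)) `^ p <= 2^-1 * (a `^ p + b `^ p).
Proof.
move=> p1 a0 b0.
have := @powR_jensen R 2 p (fun=> 2^-1) (fun i => if i == 0 then a else b) p1.
rewrite !big_ord_recl !big_ord0 /= !addr0 -!mulrDr; apply.
- by move=> _; lra.
- by move=> i; case: ifP.
- lra.
Qed.

Lemma half_addxx (R : realType) (x : R) : 2^-1 * (x + x) = x.
Proof. by field. Qed.

Lemma half_add_le (R : realType) (a b c : R) :
  a <= c -> b <= c -> 2^-1 * (a + b) <= c.
Proof.
by move=> ac bc; rewrite -[leRHS]half_addxx ler_wpM2l ?invr_ge0 ?lerD.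
Qed.

Lemma powR_add_le (R : realType) (p a b : R) : 1 <= p -> 0 <= a -> 0 <= b ->
  (a + b) `^ p <= 2 `^ p * (2^-1 * (a `^ p + b `^ p)).
Proof.
move=> p1 a0 b0.
apply: le_trans (ler_wpM2l (powR_ge0 _ _) (powR_midpoint p1 a0 b0)).
by rewrite -powRM ?mulr_ge0 ?addr_ge0 ?invr_ge0 // mulrA divff // mul1r.
Qed.

(** * Adjoints, partial isometries and real diagonals *)

(** Valued in R rather than R[i], to serve as a weight for real powers. *)
Definition normsq (R : realType) (z : R[i]) : R :=
  complex.Re z ^+ 2 + complex.Im z ^+ 2.

Lemma normsqE (R : realType) (z : R[i]) : (normsq z)%:C = z * Num.conj z.
Proof. by rewrite /normsq add_Re2_Im2 normCK. Qed.

Lemma normsq_ge0 (R : realType) (z : R[i]) : 0 <= normsq z.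
Proof. by rewrite addr_ge0 // sqr_ge0. Qed.

Lemma normsq_conj (R : realType) (z : R[i]) : normsq (Num.conj z) = normsq z.
Proof. by apply: (@complexI R); rewrite !normsqE conjCK mulrC. Qed.

Lemma adjM (R : realType) (m n k : nat) (A : 'M[R[i]]_(m, n))
    (B : 'M[R[i]]_(n, k)) : (A *m B)^t* = B^t* *m A^t*.
Proof. by rewrite trmx_mul map_mxM. Qed.

Lemma adjD (R : realType) (m n : nat) (A B : 'M[R[i]]_(m, n)) :
  (A + B)^t* = A^t* + B^t*.
Proof. by apply/matrixP => i j; rewrite !mxE rmorphD. Qed.

Lemma adjZ (R : realType) (m n : nat) (a : R[i]) (A : 'M[R[i]]_(m, n)) :
  (a *: A)^t* = Num.conj a *: A^t*.
Proof. by apply/matrixP => i j; rewrite !mxE rmorphM. Qed.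

Lemma adj_sum (R : realType) (m n : nat) (I : finType)
    (A : I -> 'M[R[i]]_(m, n)) : (\sum_i A i)^t* = \sum_i (A i)^t*.
Proof.
apply/matrixP => i j; rewrite !(mxE, summxE) rmorph_sum.
by apply: eq_bigr => k _; rewrite !mxE.
Qed.

Definition rdiag (R : realType) (n : nat) (d : 'rV[R]_n) : 'M[R[i]]_n :=
  diag_mx (map_mx (real_complex R) d).

Lemma adj_rdiag (R : realType) (n : nat) (d : 'rV[R]_n) :
  (rdiag d)^t* = rdiag d.
Proof.
rewrite /rdiag tr_diag_mx map_diag_mx; congr diag_mx.
by apply/matrixP => i j; rewrite !mxE; apply: conjc_real.
Qed.

Lemma rdiagM (R : realType) (n : nat) (d e : 'rV[R]_n) :
  rdiag d *m rdiag e = rdiag (\row_j (d 0 j * e 0 j)).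
Proof.
rewrite /rdiag mulmx_diag; congr diag_mx.
by apply/matrixP => i j; rewrite !mxE rmorphM.
Qed.

Lemma mulmx_rdiag_adj (R : realType) (m n : nat) (W : 'M[R[i]]_(m, n))
    (d : 'rV[R]_n) (i : 'I_m) :
  (W *m rdiag d *m W^t*) i i = (\sum_j normsq (W i j) * d 0 j)%:C.
Proof.
rewrite mxE rmorph_sum; apply: eq_bigr => j _.
by rewrite /rdiag mul_mx_diag !mxE rmorphM /= normsqE mulrAC.
Qed.

Lemma mulmx_adj_diag (R : realType) (m n : nat) (W : 'M[R[i]]_(m, n))
    (i : 'I_m) : (W *m W^t*) i i = (\sum_j normsq (W i j))%:C.
Proof.
rewrite mxE rmorph_sum; apply: eq_bigr => j _.
by rewrite !mxE /= normsqE.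
Qed.

Lemma mulmx_adj_eq0 (R : realType) (m n : nat) (B : 'M[R[i]]_(m, n)) :
  B *m B^t* = 0 -> B = 0.
Proof.
move=> B0; apply/matrixP => i j; rewrite [RHS]mxE.
have : \sum_j normsq (B i j) = 0.
  by apply: (@complexI R); rewrite -mulmx_adj_diag B0 mxE.
move=> /eqP; rewrite psumr_eq0 => [/allP/(_ j)|k _]; last exact: normsq_ge0.
rewrite mem_index_enum => /(_ isT) /eqP /(congr1 (real_complex R)).
by rewrite normsqE => /eqP; rewrite mulf_eq0 conjC_eq0 orbb => /eqP.
Qed.

(** Partial isometries.  They stand in for unitary matrices where the singular
    vectors of a singular or rectangular matrix would have to be completed to
    an orthonormal basis. *)
Definition pisom (R : realType) (m n : nat) (W : 'M[R[i]]_(m, n)) : Prop :=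
  W *m W^t* *m W = W.

Lemma pisom_adj (R : realType) (m n : nat) (W : 'M[R[i]]_(m, n)) :
  pisom W -> pisom (W^t*).
Proof.
by move=> /(congr1 (fun X => X^t*)); rewrite /pisom !adjM trmxCK mulmxA.
Qed.

Lemma unitary_pisom (R : realType) (n : nat) (U : 'M[R[i]]_n) :
  U \is unitarymx -> pisom U.
Proof. by move=> /unitarymxP; rewrite /pisom => ->; rewrite mul1mx. Qed.

(** The diagonal entries t of the orthogonal projection W W^* satisfy
    t^2 <= t. *)
Lemma pisom_row_le1 (R : realType) (m n : nat) (W : 'M[R[i]]_(m, n)) i :
  pisom W -> \sum_j normsq (W i j) <= 1.
Proof.
move=> pW; set t := (X in X <= _).
have Wt : (W *m W^t*) i i = t%:C by rewrite mulmx_adj_diag.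
have t0 : 0 <= t by apply: sumr_ge0 => j _; apply: normsq_ge0.
have : t ^+ 2 <= t.
  have tE : t = \sum_j normsq ((W *m W^t*) i j).
    apply: (@complexI R); rewrite -[RHS]mulmx_adj_diag -Wt adjM trmxCK.
    by rewrite mulmxA (pW : W *m W^t* *m W = W).
  rewrite [leRHS]tE (bigD1 i) //= Wt {1}/normsq /= expr0n addr0 lerDl.
  by apply: sumr_ge0 => j _; apply: normsq_ge0.
move=> tt; rewrite leNgt; apply/negP => t1.
by move: tt; rewrite expr2 leNgt -{1}[t]mulr1 ltr_pM2l // ?t1 //; lra.
Qed.

(** Jensen along the rows (whose square weights sum to at most 1), followed
    by a summation along the columns (likewise).  For unitary W this is the
    Peierls inequality: the diagonal of a positive matrix in any orthonormal
    basis has at most the l^p norm of its spectrum. *)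
Lemma peierls (R : realType) (m n : nat) (p : R) (W : 'M[R[i]]_(m, n))
    (d : 'rV[R]_n) : 1 <= p -> pisom W -> (forall j, 0 <= d 0 j) ->
  \sum_i (\sum_j normsq (W i j) * d 0 j) `^ p <= \sum_j d 0 j `^ p.
Proof.
move=> p1 pW d0.
apply: (@le_trans _ _ (\sum_i \sum_j normsq (W i j) * d 0 j `^ p)).
  apply: ler_sum => i _; apply: powR_jensen => // [j|].
    exact: normsq_ge0.
  exact: pisom_row_le1.
rewrite exchange_big /=; apply: ler_sum => j _.
rewrite -mulr_suml ler_piMl ?powR_ge0 //.
have := pisom_row_le1 j (pisom_adj pW).
by under eq_bigr do rewrite !mxE normsq_conj.
Qed.

(** * Hermitian forms and the functional calculus *)

(** Vectors are rows, as in the decomposition X = U^* D U whose eigenvectors are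
    the rows of U. *)
Definition hform (R : realType) (n : nat) (X : 'M[R[i]]_n)
    (x : 'rV[R[i]]_n) : R :=
  complex.Re ((x *m X *m x^t*) 0 0).

Lemma hformD (R : realType) (n : nat) (X Y : 'M[R[i]]_n) x :
  hform (X + Y) x = hform X x + hform Y x.
Proof. by rewrite /hform mulmxDr mulmxDl mxE raddfD. Qed.

Lemma hformZ (R : realType) (n : nat) (a : R) (X : 'M[R[i]]_n) x :
  hform (a%:C *: X) x = a * hform X x.
Proof.
rewrite /hform -scalemxAr -scalemxAl mxE.
by case: (_ 0 0) => u v /=; rewrite mul0r subr0.
Qed.

Lemma hform_sum (R : realType) (n : nat) (I : finType) (X : I -> 'M[R[i]]_n) x :
  hform (\sum_i X i) x = \sum_i hform (X i) x.
Proof.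
by rewrite /hform mulmx_sumr mulmx_suml summxE raddf_sum.
Qed.

Lemma hform_rdiag (R : realType) (m n : nat) (U : 'M[R[i]]_(m, n))
    (d : 'rV[R]_m) x :
  hform (U^t* *m rdiag d *m U) x = \sum_j normsq ((x *m U^t*) 0 j) * d 0 j.
Proof.
rewrite /hform -[RHS]/(complex.Re (\sum_j _ * d 0 j)%:C) -mulmx_rdiag_adj.
by rewrite adjM trmxCK !mulmxA.
Qed.

Lemma hform_gram (R : realType) (m n : nat) (A : 'M[R[i]]_(m, n)) x :
  hform (A^t* *m A) x = \sum_j normsq ((x *m A^t*) 0 j).
Proof.
rewrite /hform -[RHS]/(complex.Re (\sum_j normsq _)%:C) -mulmx_adj_diag.
by rewrite adjM trmxCK !mulmxA.
Qed.

Definition psd (R : realType) (n : nat) (X : 'M[R[i]]_n) : Prop :=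
  X^t* = X /\ forall x, 0 <= hform X x.

Lemma psd_rdiag (R : realType) (m n : nat) (U : 'M[R[i]]_(m, n))
    (d : 'rV[R]_m) :
  (forall j, 0 <= d 0 j) -> psd (U^t* *m rdiag d *m U).
Proof.
move=> d0; split; first by rewrite !adjM adj_rdiag trmxCK mulmxA.
move=> x; rewrite hform_rdiag; apply: sumr_ge0 => j _.
by rewrite mulr_ge0 ?normsq_ge0.
Qed.

Lemma psd_gram (R : realType) (m n : nat) (A : 'M[R[i]]_(m, n)) :
  psd (A^t* *m A).
Proof.
split; first by rewrite adjM trmxCK.
by move=> x; rewrite hform_gram; apply: sumr_ge0 => j _; apply: normsq_ge0.
Qed.

Lemma psdD (R : realType) (n : nat) (X Y : 'M[R[i]]_n) :
  psd X -> psd Y -> psd (X + Y).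
Proof.
move=> [X1 X2] [Y1 Y2]; split; first by rewrite adjD X1 Y1.
by move=> x; rewrite hformD addr_ge0.
Qed.

Lemma psdZ (R : realType) (n : nat) (a : R) (X : 'M[R[i]]_n) :
  0 <= a -> psd X -> psd (a%:C *: X).
Proof.
move=> a0 [X1 X2]; split; last by move=> x; rewrite hformZ mulr_ge0.
by rewrite adjZ X1; congr (_ *: _); apply: conjc_real.
Qed.

Lemma psd_sum (R : realType) (n : nat) (I : finType) (X : I -> 'M[R[i]]_n) :
  (forall i, psd (X i)) -> psd (\sum_i X i).
Proof.
move=> X0; split; first by rewrite adj_sum; apply: eq_bigr => i _; case: (X0 i).
by move=> x; rewrite hform_sum; apply: sumr_ge0 => i _; case: (X0 i).
Qed.

(** Taking real parts loses nothing for the Hermitian matrices considered. *)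
Definition eigs (R : realType) (n : nat) (X : 'M[R[i]]_n) : 'rV[R]_n :=
  map_mx (@complex.Re R) (spectral_diag X).

Lemma herm_spectral (R : realType) (n : nat) (X : 'M[R[i]]_n) : X^t* = X ->
  X = (spectralmx X)^t* *m rdiag (eigs X) *m spectralmx X.
Proof.
move=> hX; have uV := spectral_unitarymx X.
have /orthomx_spectralP XE : X \is normalmx by apply/normalmxP; rewrite hX.
rewrite (invmx_unitary uV) in XE.
suff -> : rdiag (eigs X) = diag_mx (spectral_diag X) by [].
have VX : spectralmx X *m X *m (spectralmx X)^t* = diag_mx (spectral_diag X).
  by rewrite [X in _ *m X *m _]XE !mulmxA (unitarymxP uV) mul1mx mulmxtVK.
have /matrixP VH : (diag_mx (spectral_diag X))^t* = diag_mx (spectral_diag X).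
  by rewrite -VX !adjM trmxCK hX mulmxA.
congr diag_mx; apply/rowP => j; rewrite !mxE; apply: RRe_real.
have := VH j j; rewrite !mxE eqxx !mulr1n => /CrealP; exact.
Qed.

Lemma eigsE (R : realType) (n : nat) (X : 'M[R[i]]_n) j : X^t* = X ->
  eigs X 0 j = hform X (row j (spectralmx X)).
Proof.
move=> /herm_spectral XE; rewrite [X in hform X]XE hform_rdiag.
rewrite -row_mul (unitarymxP (spectral_unitarymx X)) (bigD1 j) //= big1.
  by rewrite /normsq !mxE eqxx /= expr1n expr0n !addr0 mul1r.
by move=> k /negPf kj; rewrite /normsq !mxE eq_sym kj /= expr0n addr0 mul0r.
Qed.

Lemma eigs_ge0 (R : realType) (n : nat) (X : 'M[R[i]]_n) j :
  psd X -> 0 <= eigs X 0 j.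
Proof. by move=> [hX X0]; rewrite eigsE. Qed.

Lemma unitary_adjK (R : realType) (n : nat) (U : 'M[R[i]]_n) :
  U \is unitarymx -> U^t* *m U = 1%:M.
Proof. by move=> /unitarymxP uU; apply: mulmx1C. Qed.

(** If V and U both diagonalize the same matrix, then V U^* intertwines the
    two diagonals, hence also their images under f. *)
Lemma mxfunE (R : realType) (n : nat) (f : R[i] -> R[i]) (U : 'M[R[i]]_n) d :
  U \is unitarymx ->
  mxfun f (U^t* *m diag_mx d *m U) = U^t* *m diag_mx (map_mx f d) *m U.
Proof.
move=> uU; have UU := unitary_adjK uU.
have [B BU] : {B | B = U^t* *m diag_mx d *m U}.
  by exists (U^t* *m diag_mx d *m U).
have nB : B \is normalmx.
  apply/orthomx_spectral_subproof; exists (U, d) => //=.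
  by rewrite (invmx_unitary uU).
have uV := spectral_unitarymx B; have VV := unitary_adjK uV.
have /orthomx_spectralP BE := nB; rewrite (invmx_unitary uV) in BE.
rewrite -BU /mxfun (invmx_unitary uV).
move: (spectralmx B) (spectral_diag B) uV VV BE => V e uV VV BE.
have /matrixP W1 : diag_mx e *m (V *m U^t*) = V *m U^t* *m diag_mx d.
  have -> : diag_mx e *m (V *m U^t*) = V *m B *m U^t*.
    by rewrite BE !mulmxA (unitarymxP uV) mul1mx.
  by rewrite BU !mulmxA (mulmxtVK _ uU).
have W2 : diag_mx (map_mx f e) *m (V *m U^t*)
    = V *m U^t* *m diag_mx (map_mx f d).
  apply/matrixP => i j; have := W1 i j.
  rewrite !mul_diag_mx !mul_mx_diag !mxE.
  set w := \sum_k _; have [->|w0] := eqVneq w 0; first by rewrite !mulr0 !mul0r.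
  by rewrite [RHS]mulrC => /(mulIf w0) ->; rewrite mulrC.
have := congr1 (fun X => V^t* *m X *m U) W2; rewrite !mulmxA VV mul1mx => <-.
by rewrite -[RHS]mulmxA UU mulmx1.
Qed.

(** For positive X, the p-th power of the Schatten p-norm. *)
Definition tpow (R : realType) (n : nat) (p : R) (X : 'M[R[i]]_n) : R :=
  complex.Re (\tr (psd_powR X p)).

Lemma tpow_conj (R : realType) (n : nat) (p : R) (U : 'M[R[i]]_n)
    (d : 'rV[R]_n) :
  U \is unitarymx -> tpow p (U^t* *m rdiag d *m U) = \sum_j d 0 j `^ p.
Proof.
move=> uU; rewrite /tpow /psd_powR mxfunE // mxtrace_mulC mulmxA.
rewrite (unitarymxP uU) mul1mx mxtrace_diag raddf_sum.
by apply: eq_bigr => j _; rewrite !mxE.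
Qed.

Lemma tpow_eigs (R : realType) (n : nat) (p : R) (X : 'M[R[i]]_n) :
  psd X -> tpow p X = \sum_j eigs X 0 j `^ p.
Proof.
move=> [hX _]; rewrite {1}(herm_spectral hX) tpow_conj //.
exact: spectral_unitarymx.
Qed.

Lemma tpow_ge0 (R : realType) (n : nat) (p : R) (X : 'M[R[i]]_n) :
  psd X -> 0 <= tpow p X.
Proof.
by move=> X0; rewrite tpow_eigs //; apply: sumr_ge0 => j _; apply: powR_ge0.
Qed.

(** In an eigenbasis of S, the functional calculus of S^2 takes the squares of the
    nonnegative eigenvalues of S back to them. *)
Lemma absmx_unique (R : realType) (n : nat) (S Z : 'M[R[i]]_n) :
  psd S -> S *m S = Z^t* *m Z -> absmx Z = S.
Proof.
move=> S0 SS; have [hS _] := S0; have SE := herm_spectral hS.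
have uV := spectral_unitarymx S.
have rtE : map_mx sqrtC
    (map_mx (real_complex R) (\row_j (eigs S 0 j * eigs S 0 j)))
    = map_mx (real_complex R) (eigs S).
  have e0 j : 0 <= eigs S 0 j by apply: eigs_ge0.
  move: (eigs S) e0 => e e0; apply/rowP => j; rewrite !mxE rmorphM /= -expr2.
  by rewrite sqrCK // ler0c.
rewrite /absmx -SS {1 2}SE !mulmxA (mulmxtVK _ uV).
rewrite -[_ *m rdiag _ *m rdiag _]mulmxA rdiagM [in LHS]/rdiag.
by rewrite (mxfunE _ _ uV) rtE; exact: esym SE.
Qed.

Lemma absmx_psd (R : realType) (n : nat) (S : 'M[R[i]]_n) :
  psd S -> absmx S = S.
Proof. by move=> S0; apply: absmx_unique => //; case: S0 => ->. Qed.

(** * Singular value decomposition *)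

(** Diagonalize A^* A for V and the squares of s.  The rows of U are the images
    of the right singular vectors, normalized when the singular value is
    nonzero and 0 otherwise, which makes U a partial isometry. *)
Lemma svd (R : realType) (m n : nat) (A : 'M[R[i]]_(m, n)) :
  exists (U : 'M[R[i]]_(n, m)) (s : 'rV[R]_n) (V : 'M[R[i]]_n),
  [/\ A = U^t* *m rdiag s *m V, V \is unitarymx, pisom U,
      U *m U^t* *m rdiag s = rdiag s & forall j, 0 <= s 0 j].
Proof.
have P0 := psd_gram A; have [hP _] := P0.
set d := eigs (A^t* *m A); set V := spectralmx (A^t* *m A).
have uV : V \is unitarymx by apply: spectral_unitarymx.
have VV := unitary_adjK uV.
have PE : V *m (A^t* *m A) *m V^t* = rdiag d.
  rewrite [A^t* *m A]herm_spectral // !mulmxA (unitarymxP uV) mul1mx.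
  by rewrite mulmxtVK.
have d0 j : 0 <= d 0 j by apply: eigs_ge0.
pose s : 'rV[R]_n := map_mx Num.sqrt d.
(* Pseudo-inverse of s, since 0^-1 = 0; its product with s is the support e. *)
pose t : 'rV[R]_n := map_mx GRing.inv s.
pose e : 'rV[R]_n := \row_j (s 0 j != 0)%:R.
have ts : rdiag t *m rdiag s = rdiag e.
  rewrite rdiagM; congr rdiag; apply/rowP => j.
  rewrite [RHS]mxE [LHS]mxE /t [map_mx _ _ _ _]mxE.
  by have [->|s0] := eqVneq (s 0 j) 0; rewrite ?mulr0 // mulVf.
have st : rdiag s *m rdiag t = rdiag e.
  by rewrite -ts !rdiagM; congr rdiag; apply/rowP => j; rewrite !mxE mulrC.
have es : rdiag e *m rdiag s = rdiag s.
  rewrite rdiagM; congr rdiag; apply/rowP => j; rewrite mxE [e 0 j]mxE.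
  by have [->|_] := eqVneq (s 0 j) 0; rewrite ?mulr0 ?mul1r.
have et : rdiag e *m rdiag t = rdiag t.
  rewrite rdiagM; congr rdiag; apply/rowP => j.
  rewrite mxE [e 0 j]mxE [t 0 j]mxE.
  by have [->|_] := eqVneq (s 0 j) 0; rewrite ?mul0r ?invr0 ?mul1r.
have ss : rdiag s *m rdiag s = rdiag d.
  rewrite rdiagM; congr rdiag; apply/rowP => j; rewrite mxE [s 0 j]mxE.
  by rewrite -expr2 sqr_sqrtr.
pose U := rdiag t *m V *m A^t*.
have UU : U *m U^t* = rdiag e.
  rewrite /U !adjM trmxCK adj_rdiag.
  have -> : rdiag t *m V *m A^t* *m (A *m (V^t* *m rdiag t))
    = rdiag t *m (V *m (A^t* *m A) *m V^t*) *m rdiag t by rewrite !mulmxA.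
  by rewrite PE -ss !mulmxA ts es st.
have ed : rdiag e *m rdiag d = rdiag d by rewrite -ss mulmxA es.
have de : rdiag d *m rdiag e = rdiag d.
  by rewrite -[RHS]ed !rdiagM; congr rdiag; apply/rowP => j; rewrite !mxE mulrC.
(* A V^* has orthogonal columns, and those of square norm d_j = 0 vanish. *)
have Ae : A *m V^t* *m rdiag e = A *m V^t*.
  apply/esym/eqP; rewrite -subr_eq0; apply/eqP.
  set B := A *m V^t*; have BB : B^t* *m B = rdiag d.
    by rewrite -PE /B adjM trmxCK !mulmxA.
  clearbody B; rewrite -[LHS]trmxCK.
  suff -> : (B - B *m rdiag e)^t* = 0 by rewrite trmx0 map_mx0.
  apply: mulmx_adj_eq0; rewrite trmxCK.
  have -> : (B - B *m rdiag e)^t* = B^t* - rdiag e *m B^t*.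
    rewrite -[- (_ *m rdiag e)]scaleN1r adjD adjZ adjM adj_rdiag rmorphN1.
    by rewrite scaleN1r.
  rewrite mulmxBl !mulmxBr -!mulmxA [B^t* *m (B *m _)]mulmxA BB de ed.
  by rewrite !subrr.
exists U, s, V; split => //.
- rewrite /U !adjM trmxCK adj_rdiag -[_ *m rdiag s]mulmxA.
  rewrite -(mulmxA _ (rdiag t)) ts mulmxA Ae.
  by rewrite -mulmxA VV mulmx1.
- by rewrite /pisom UU /U !mulmxA et.
- by rewrite UU.
- by move=> j; rewrite mxE sqrtr_ge0.
Qed.

(** * The modulus and domination by positive pairs *)

Lemma svd_absmx (R : realType) (n : nat) (U V : 'M[R[i]]_n) (s : 'rV[R]_n)
    (A := U^t* *m rdiag s *m V) :
  V \is unitarymx -> U *m U^t* *m rdiag s = rdiag s -> (forall j, 0 <= s 0 j) ->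
  absmx A = V^t* *m rdiag s *m V /\ absmx (A^t*) = U^t* *m rdiag s *m U.
Proof.
move=> uV Us s0.
have AE : A^t* = V^t* *m rdiag s *m U by rewrite !adjM trmxCK adj_rdiag mulmxA.
split; apply: absmx_unique; rewrite ?AE; try exact: psd_rdiag.
  rewrite /A !mulmxA (mulmxtVK _ uV).
  by rewrite -[X in _ = X *m _ *m _]mulmxA -[X in _ = X *m _]mulmxA Us.
rewrite !adjM trmxCK adj_rdiag !mulmxA (mulmxtVK _ uV).
by rewrite -[X in X *m _ *m _ = _]mulmxA -[X in X *m _ = _]mulmxA Us.
Qed.

Lemma psd_absmx (R : realType) (n : nat) (A : 'M[R[i]]_n) : psd (absmx A).
Proof.
have [U [s [V [-> uV _ Us s0]]]] := svd A.
by have [-> _] := svd_absmx uV Us s0; apply: psd_rdiag.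
Qed.

Lemma absmx_sqr (R : realType) (n : nat) (A : 'M[R[i]]_n) :
  absmx A *m absmx A = A^t* *m A.
Proof.
have [U [s [V [-> uV _ Us s0]]]] := svd A.
have [-> _] := svd_absmx uV Us s0.
rewrite !adjM trmxCK adj_rdiag !mulmxA (mulmxtVK _ uV).
by rewrite -[X in _ = X *m _ *m _]mulmxA -[X in _ = X *m _]mulmxA Us.
Qed.

Lemma half_RC (R : realType) : (2^-1 : R[i]) = (2^-1 : R)%:C.
Proof. by rewrite fmorphV rmorph_nat. Qed.

Lemma psd_half (R : realType) (n : nat) (X : 'M[R[i]]_n) :
  psd X -> psd (2^-1 *: X).
Proof. by rewrite half_RC; apply: psdZ; rewrite invr_ge0. Qed.

Lemma psd_symabsmx (R : realType) (n : nat) (A : 'M[R[i]]_n) : psd (symabsmx A).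
Proof. by apply/psd_half/psdD; apply: psd_absmx. Qed.

(** Equivalent to positivity of the block matrix with diagonal blocks Q, P and
    off-diagonal blocks A, A^*; this form is visibly additive in (A, Q, P). *)
Definition dominates (R : realType) (n : nat) (A Q P : 'M[R[i]]_n) : Prop :=
  forall x y : 'rV[R[i]]_n,
    `|(x *m A *m y^t*) 0 0| <= (2^-1 * (hform Q x + hform P y))%:C.

(** In the coordinates a, b of x, y along the singular vectors, this is
    s_j |a_j| |b_j| <= s_j (|a_j|^2 + |b_j|^2) / 2. *)
Lemma dominates_absmx (R : realType) (n : nat) (A : 'M[R[i]]_n) :
  dominates A (absmx (A^t*)) (absmx A).
Proof.
have [U [s [V [-> uV _ Us s0]]]] := svd A.
have [-> ->] := svd_absmx uV Us s0 => x y.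
rewrite !hform_rdiag -big_split /= mulr_sumr rmorph_sum /=.
have -> : x *m (U^t* *m rdiag s *m V) *m y^t*
    = x *m U^t* *m rdiag s *m (y *m V^t*)^t*.
  by rewrite adjM trmxCK !mulmxA.
set a := x *m U^t*; set b := y *m V^t*; clearbody a b.
rewrite mxE; apply: le_trans (ler_norm_sum _ _ _) _; apply: ler_sum => j _.
rewrite /rdiag mul_mx_diag !mxE !normrM norm_conjC.
rewrite [`|_%:C|]ger0_norm ?ler0c // -mulrDl !rmorphM rmorphD /=.
rewrite !normsqE -!normCK fmorphV rmorph_nat [leRHS]mulrA mulrAC.
apply: ler_wpM2r; first by rewrite ler0c.
rewrite -subr_ge0.
have -> : 2^-1 * (`|a 0 j| ^+ 2 + `|b 0 j| ^+ 2) - `|a 0 j| * `|b 0 j|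
  = 2^-1 * (`|a 0 j| - `|b 0 j|) ^+ 2 by field.
by rewrite mulr_ge0 ?invr_ge0 // real_exprn_even_ge0 // rpredB ?normr_real.
Qed.

Lemma dominates_sum (R : realType) (n : nat) (I : finType)
    (A Q P : I -> 'M[R[i]]_n) :
  (forall k, dominates (A k) (Q k) (P k)) ->
  dominates (\sum_k A k) (\sum_k Q k) (\sum_k P k).
Proof.
move=> dA x y; rewrite mulmx_sumr mulmx_suml summxE !hform_sum -big_split /=.
rewrite mulr_sumr rmorph_sum; apply: le_trans (ler_norm_sum _ _ _) _.
by apply: ler_sum => k _; apply: dA.
Qed.

Lemma dominates_adj (R : realType) (n : nat) (A Q P : 'M[R[i]]_n) :
  dominates A Q P -> dominates (A^t*) P Q.
Proof.
move=> dA x y; have := dA y x; rewrite addrC.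
congr (_ <= _); rewrite -[LHS]norm_conjC; congr `|_|.
have -> : x *m A^t* *m y^t* = (y *m A *m x^t*)^t*.
  by rewrite !adjM trmxCK mulmxA.
by rewrite [RHS]mxE [X in _ = Num.conj X]mxE.
Qed.

Lemma row_form (R : realType) (m n : nat) (A : 'M[R[i]]_n)
    (U V : 'M[R[i]]_(m, n)) i j :
  (row i U *m A *m (row j V)^t*) 0 0 = (U *m A *m V^t*) i j.
Proof. by rewrite -row_mul !mxE; apply: eq_bigr => k _; rewrite !mxE. Qed.

(** * Inequalities for traces of powers *)

Lemma pisom_mulmx_unitary (R : realType) (m n : nat) (W : 'M[R[i]]_(m, n))
    (V : 'M[R[i]]_n) : pisom W -> V \is unitarymx -> pisom (W *m V^t*).
Proof.
move=> pW uV; rewrite /pisom adjM trmxCK !mulmxA (mulmxKtV _ uV erefl).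
by rewrite (pW : _ = W).
Qed.

Lemma tpow_peierls (R : realType) (m n : nat) (p : R) (W : 'M[R[i]]_(m, n))
    (X : 'M[R[i]]_n) : 1 <= p -> pisom W -> psd X ->
  \sum_i hform X (row i W) `^ p <= tpow p X.
Proof.
move=> p1 pW X0; have [hX _] := X0; rewrite (tpow_eigs p X0).
have uV := spectral_unitarymx X.
have pWV := pisom_mulmx_unitary pW uV.
apply: le_trans (peierls p1 pWV (fun j => eigs_ge0 j X0)).
rewrite le_eqVlt; apply/orP; left; apply/eqP; apply: eq_bigr => i _.
rewrite {1}(herm_spectral hX) hform_rdiag -row_mul; congr (_ `^ _).
by apply: eq_bigr => j _; rewrite [X in normsq X]mxE.
Qed.

Lemma tpowZ (R : realType) (n : nat) (p a : R) (X : 'M[R[i]]_n) :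
  0 <= a -> psd X -> tpow p (a%:C *: X) = a `^ p * tpow p X.
Proof.
move=> a0 X0; have [hX _] := X0; rewrite (tpow_eigs p X0).
rewrite {1}(herm_spectral hX) scalemxAl scalemxAr.
have -> : a%:C *: rdiag (eigs X) = rdiag (\row_j (a * eigs X 0 j)).
  rewrite /rdiag; apply/matrixP => i j; rewrite !mxE rmorphM /=.
  by case: eqP => _; rewrite ?mulr0n ?mulr0.
rewrite tpow_conj ?spectral_unitarymx // mulr_sumr; apply: eq_bigr => j _.
by rewrite mxE powRM // eigs_ge0.
Qed.

(** With T the column of the square roots of P and Q, the matrices T^* T = P + Q
    and T T^* have the same nonzero spectrum, and the latter has the eigenvalues
    of P and Q on its diagonal, up to a change of orthonormal basis. *)
Lemma tpow_superadd (R : realType) (n : nat) (p : R) (P Q : 'M[R[i]]_n) :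
  1 <= p -> psd P -> psd Q -> tpow p P + tpow p Q <= tpow p (P + Q).
Proof.
move=> p1 P0 Q0.
pose rt (X : 'M[R[i]]_n) := rdiag (map_mx Num.sqrt (eigs X)) *m spectralmx X.
have rtsq (X : 'M[R[i]]_n) : psd X -> rdiag (map_mx Num.sqrt (eigs X)) *m
    rdiag (map_mx Num.sqrt (eigs X)) = rdiag (eigs X).
  move=> X0; rewrite rdiagM; congr rdiag; apply/rowP => j.
  have := eigs_ge0 j X0; move: (eigs X) => e e0.
  by rewrite !mxE -expr2 sqr_sqrtr.
have rt1 (X : 'M[R[i]]_n) : psd X -> (rt X)^t* *m rt X = X.
  move=> X0; have [hX _] := X0.
  rewrite /rt adjM adj_rdiag [RHS]herm_spectral // -(rtsq X) //.
  by rewrite !mulmxA.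
have rt2 (X : 'M[R[i]]_n) : psd X -> rt X *m (rt X)^t* = rdiag (eigs X).
  move=> X0; rewrite /rt adjM adj_rdiag mulmxA mulmxtVK ?spectral_unitarymx //.
  exact: rtsq.
clearbody rt; clear rtsq.
pose T := col_mx (rt P) (rt Q).
have TE : T^t* = row_mx ((rt P)^t*) ((rt Q)^t*).
  by rewrite /T tr_col_mx map_row_mx.
have TT1 : T^t* *m T = P + Q by rewrite TE mul_row_col !rt1.
have TT3 : T *m T^t* = block_mx (rdiag (eigs P)) (rt P *m (rt Q)^t*)
                                (rt Q *m (rt P)^t*) (rdiag (eigs Q)).
  by rewrite TE mul_col_row !rt2.
clearbody T; have [U [s [V [TUV uV pU Us s0]]]] := svd T.
pose d : 'rV[R]_n := \row_j (s 0 j * s 0 j).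
have d0 j : 0 <= d 0 j by rewrite mxE mulr_ge0.
have PQE : P + Q = V^t* *m rdiag d *m V.
  rewrite -TT1 TUV !adjM trmxCK adj_rdiag -rdiagM.
  by rewrite !mulmxA -[X in X *m _ *m _ = _]mulmxA -[X in X *m _ = _]mulmxA Us.
have TT2 : T *m T^t* = U^t* *m rdiag d *m U.
  rewrite TUV !adjM trmxCK adj_rdiag -rdiagM.
  by rewrite !mulmxA mulmxtVK.
have diagE k : (T *m T^t*) k k = (\sum_j normsq (U^t* k j) * d 0 j)%:C.
  by rewrite TT2 -mulmx_rdiag_adj trmxCK.
rewrite PQE tpow_conj // !tpow_eigs //.
apply: le_trans (peierls p1 (pisom_adj pU) d0).
rewrite big_split_ord /= le_eqVlt; apply/orP; left; apply/eqP.
congr (_ + _); apply: eq_bigr => i _; congr (_ `^ _); apply: (@complexI R);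
  rewrite -diagE TT3 ?block_mxEul ?block_mxEdr /rdiag !mxE eqxx //.
Qed.

(** The singular values u_j A v_j^* of A are at most the means of the diagonal
    entries u_j Q u_j^* and v_j P v_j^*. *)
Lemma tpow_absmx_le (R : realType) (n : nat) (p : R) (A Q P : 'M[R[i]]_n) :
  1 <= p -> psd Q -> psd P -> dominates A Q P ->
  tpow p (absmx A) <= 2^-1 * (tpow p Q + tpow p P).
Proof.
move=> p1 Q0 P0 dA; have [U [s [V [AE uV pU Us s0]]]] := svd A.
have -> : absmx A = V^t* *m rdiag s *m V.
  by rewrite AE; have [-> _] := svd_absmx uV Us s0.
rewrite tpow_conj //.
have UAV : U *m A *m V^t* = rdiag s by rewrite AE !mulmxA (mulmxtVK _ uV) Us.
apply: (@le_trans _ _ (\sum_j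
    2^-1 * (hform Q (row j U) `^ p + hform P (row j V) `^ p))).
  apply: ler_sum => j _.
  have [_ /(_ (row j U)) q0] := Q0; have [_ /(_ (row j V)) p0] := P0.
  apply: le_trans (powR_midpoint p1 q0 p0).
  apply: ge0_ler_powR; rewrite ?nnegrE ?mulr_ge0 ?invr_ge0 ?addr_ge0 //.
    lra.
  have := dA (row j U) (row j V).
  have -> : (row j U *m A *m (row j V)^t*) 0 0 = (s 0 j)%:C.
    by rewrite row_form UAV !mxE eqxx.
  by rewrite ger0_norm ?ler0c // lecR.
rewrite -mulr_sumr big_split /=; apply: ler_wpM2l; first by rewrite invr_ge0.
apply: lerD; first exact: tpow_peierls.
by apply: tpow_peierls => //; apply: unitary_pisom.
Qed.

Lemma tpow_half (R : realType) (n : nat) (p : R) (X : 'M[R[i]]_n) : psd X ->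
  2 `^ p * tpow p (2^-1 *: X) = tpow p X.
Proof.
move=> X0; rewrite half_RC tpowZ ?invr_ge0 // mulrA -powRM ?invr_ge0 //.
by rewrite divff // powR1 mul1r.
Qed.

Lemma hform_symabsmx (R : realType) (n : nat) (A : 'M[R[i]]_n) x :
  hform (symabsmx A) x = 2^-1 * (hform (absmx A) x + hform (absmx (A^t*)) x).
Proof. by rewrite /symabsmx half_RC hformZ hformD. Qed.

(** The factor 2^(p - 1) combines the 2^p from Tr (Q + P)^p = Tr (2 M)^p with the
    mean over P and Q in tpow_absmx_le. *)
Lemma tpow_symabsmx_le (R : realType) (n : nat) (p : R) (A Q P : 'M[R[i]]_n) :
  1 <= p -> psd Q -> psd P -> dominates A Q P ->
  tpow p (symabsmx A) <= 2 `^ (p - 1) * tpow p (2^-1 *: (Q + P)).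
Proof.
move=> p1 Q0 P0 dA; have p0 : 0 < p by lra.
have -> : 2 `^ (p - 1) * tpow p (2^-1 *: (Q + P)) = 2^-1 * tpow p (Q + P).
  rewrite -[tpow p (Q + P)]tpow_half; last exact: psdD.
  by rewrite -(@mulr_powRB1 R 2 p) // !mulrA mulVf // mul1r.
have [hN _] := psd_symabsmx A.
have pV : pisom (spectralmx (symabsmx A)).
  exact/unitary_pisom/spectral_unitarymx.
have a0 := psd_absmx A; have b0 := psd_absmx (A^t*).
rewrite tpow_eigs; last exact: psd_symabsmx.
apply: (@le_trans _ _ (2^-1 * (tpow p (absmx A) + tpow p (absmx (A^t*))))).
  apply: le_trans (ler_wpM2l _ (lerD (tpow_peierls p1 pV a0)
    (tpow_peierls p1 pV b0))); last by rewrite invr_ge0.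
  rewrite -big_split mulr_sumr; apply: ler_sum => j _.
  rewrite eigsE // hform_symabsmx; apply: powR_midpoint => //.
    by case: a0.
  by case: b0.
apply: ler_wpM2l; first by rewrite invr_ge0.
have h1 := tpow_absmx_le p1 Q0 P0 dA.
have h2 := tpow_absmx_le p1 P0 Q0 (dominates_adj dA).
apply: le_trans (lerD h1 h2) _; rewrite -mulrDr [tpow p P + _]addrC half_addxx.
exact: tpow_superadd.
Qed.

(** * Real and imaginary parts *)

Definition herm_part (R : realType) (n : nat) (A : 'M[R[i]]_n) : 'M[R[i]]_n :=
  2^-1 *: (A + A^t*).

Lemma herm_part_adj (R : realType) (n : nat) (A : 'M[R[i]]_n) :
  (herm_part A)^t* = herm_part A.
Proof.
rewrite /herm_part half_RC adjZ adjD trmxCK addrC; congr (_ *: _).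
exact: conjc_real.
Qed.

Lemma hform_adj (R : realType) (n : nat) (A : 'M[R[i]]_n) x :
  hform (A^t*) x = hform A x.
Proof.
rewrite /hform.
have -> : x *m A^t* *m x^t* = (x *m A *m x^t*)^t*.
  by rewrite !adjM trmxCK mulmxA.
by rewrite 2!mxE; case: ((_ *m _) 0 0).
Qed.

Lemma hform_herm_part (R : realType) (n : nat) (A : 'M[R[i]]_n) x :
  hform (herm_part A) x = hform A x.
Proof.
by rewrite /herm_part half_RC hformZ hformD hform_adj half_addxx.
Qed.

Definition imag_part (R : realType) (n : nat) (A : 'M[R[i]]_n) : 'M[R[i]]_n :=
  herm_part (- 'i *: A).

Lemma dominates_hform (R : realType) (n : nat) (A Q P : 'M[R[i]]_n) x :
  dominates A Q P -> `|hform (herm_part A) x| <= hform (2^-1 *: (Q + P)) x.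
Proof.
move=> dA; rewrite hform_herm_part half_RC hformZ hformD -lecR.
by apply: le_trans (dA x x); rewrite normc_ge_Re.
Qed.

Lemma dominates_imag (R : realType) (n : nat) (A Q P : 'M[R[i]]_n) :
  dominates A Q P -> dominates (- 'i *: A) Q P.
Proof.
move=> dA x y; move: (dA x y); congr (_ <= _).
rewrite -scalemxAr -scalemxAl [in RHS]mxE.
by rewrite normrM normrN normCi mul1r.
Qed.

Lemma mulmxZZ (R : realType) (m n k : nat) (a b : R[i]) (X : 'M[R[i]]_(m, n))
    (Y : 'M[R[i]]_(n, k)) :
  (a *: X) *m (b *: Y) = (a * b) *: (X *m Y).
Proof. by rewrite -scalemxAl -scalemxAr scalerA. Qed.

Lemma sqr_parts (R : realType) (n : nat) (A : 'M[R[i]]_n) :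
  herm_part A *m herm_part A + imag_part A *m imag_part A
  = 2^-1 *: (A^t* *m A + A *m A^t*).
Proof.
have ic : Num.conj (- 'i : R[i]) = 'i by rewrite rmorphN /= conjCi opprK.
have -> : imag_part A = ('i * 2^-1) *: (A^t* - A).
  rewrite /imag_part /herm_part adjZ ic addrC scaleNr -scalerBr.
  by rewrite scalerA mulrC.
have i2 : 'i * 2^-1 * ('i * 2^-1) = - (2^-1 * 2^-1) :> R[i].
  by rewrite mulrACA -expr2 sqrCi mulN1r.
rewrite /herm_part !mulmxZZ i2.
rewrite !(mulmxDl, mulmxDr, mulmxN, mulNmx).
move: (A *m A) (A *m A^t*) (A^t* *m A) (A^t* *m A^t*) => aa ab ba bb.
by apply/matrixP => i j; rewrite !mxE; field.
Qed.

(** The difference of the two sides is the form of the square of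
    (|A| - |A^*|) / 2. *)
Lemma hform_symabsmx_sqr (R : realType) (n : nat) (A : 'M[R[i]]_n) x :
  hform (symabsmx A *m symabsmx A) x
  <= hform (herm_part A *m herm_part A) x
     + hform (imag_part A *m imag_part A) x.
Proof.
have [ha _] := psd_absmx A; have [hb _] := psd_absmx (A^t*).
rewrite -hformD sqr_parts.
set a := absmx A in ha; set b := absmx (A^t*) in hb.
have aa : a *m a = A^t* *m A by apply: absmx_sqr.
have bb : b *m b = A *m A^t* by rewrite /b absmx_sqr trmxCK.
have -> : symabsmx A = 2^-1 *: (a + b) by [].
clearbody a b; pose D := 2^-1 *: (a - b).
have hD : D^t* = D.
  rewrite /D half_RC -[- b]scaleN1r adjZ adjD adjZ ha hb rmorphN1.
  by congr (_ *: _); apply: conjc_real.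
have -> : 2^-1 *: (A^t* *m A + A *m A^t*)
      = (2^-1 *: (a + b)) *m (2^-1 *: (a + b)) + D^t* *m D.
  rewrite hD -aa -bb /D.
  rewrite !mulmxZZ.
  rewrite !(mulmxDl, mulmxDr, mulmxN, mulNmx).
  move: (a *m a) (a *m b) (b *m a) (b *m b) => ? ? ? ?.
  by apply/matrixP => i j; rewrite !mxE; field.
rewrite hformD lerDl; have [_] := psd_gram D; exact.
Qed.

Lemma hform_sqr (R : realType) (n : nat) (X : 'M[R[i]]_n) x : X^t* = X ->
  hform (X *m X) x
  = \sum_j normsq ((x *m (spectralmx X)^t*) 0 j) * eigs X 0 j ^+ 2.
Proof.
move=> hX; have uV := spectral_unitarymx X.
rewrite {1 2}(herm_spectral hX) !mulmxA (mulmxtVK _ uV).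
rewrite -[_ *m rdiag _ *m rdiag _]mulmxA.
by rewrite rdiagM hform_rdiag; apply: eq_bigr => j _; rewrite [X in _ * X]mxE.
Qed.

Lemma hform_sqr_eig (R : realType) (n : nat) (X : 'M[R[i]]_n) j : X^t* = X ->
  hform (X *m X) (row j (spectralmx X)) = eigs X 0 j ^+ 2.
Proof.
move=> hX; rewrite hform_sqr // -row_mul (unitarymxP (spectral_unitarymx X)).
rewrite (bigD1 j) //= big1.
  by rewrite /normsq !mxE eqxx /= expr1n expr0n !addr0 mul1r.
by move=> k /negPf kj; rewrite /normsq !mxE eq_sym kj /= expr0n addr0 mul0r.
Qed.

(** If -M <= H <= M as quadratic forms, the moduli of the eigenvalues of H are
    bounded by diagonal entries of M in an eigenbasis of H. *)
Lemma herm_sqr_tpow_le (R : realType) (m n : nat) (p : R)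
    (W : 'M[R[i]]_(m, n)) (H M : 'M[R[i]]_n) :
  2 <= p -> pisom W -> H^t* = H -> psd M ->
  (forall x, `|hform H x| <= hform M x) ->
  \sum_i hform (H *m H) (row i W) `^ (p / 2) <= tpow p M.
Proof.
move=> p2 pW hH M0 HM; have p1 : 1 <= p / 2 by lra.
have uV := spectral_unitarymx H; set V := spectralmx H in uV *.
pose d : 'rV[R]_n := \row_j eigs H 0 j ^+ 2.
have d0 j : 0 <= d 0 j by rewrite mxE sqr_ge0.
have pWV := pisom_mulmx_unitary pW uV.
apply: (@le_trans _ _ (\sum_j d 0 j `^ (p / 2))).
  apply: le_trans (peierls p1 pWV d0).
  rewrite le_eqVlt; apply/orP; left; apply/eqP; apply: eq_bigr => i _.
  rewrite hform_sqr //; congr (_ `^ _).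
  by apply: eq_bigr => j _; rewrite -/V -row_mul [X in normsq X]mxE [d 0 j]mxE.
apply: le_trans (tpow_peierls (_ : 1 <= p) (unitary_pisom uV) M0); last by lra.
apply: ler_sum => j _; rewrite mxE -[_ ^+ 2]real_normK ?num_real //.
rewrite -powR_mulrn // -powRrM.
have -> : 2%:R * (p / 2) = p :> R by field.
apply: ge0_ler_powR; rewrite ?nnegrE ?normr_ge0 //; first lra.
  by case: M0.
by rewrite eigsE.
Qed.

(** In an eigenbasis of |A|_sym, the squared eigenvalues are at most the sum of
    the diagonal entries of H^2 and K^2; the hypothesis 2 <= p makes the power
    p / 2 convex. *)
Lemma tpow_symabsmx_le_ge2 (R : realType) (n : nat) (p : R)
    (A Q P : 'M[R[i]]_n) :
  2 <= p -> psd Q -> psd P -> dominates A Q P ->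
  tpow p (symabsmx A) <= 2 `^ (p / 2) * tpow p (2^-1 *: (Q + P)).
Proof.
move=> p2 Q0 P0 dA; have p1 : 1 <= p / 2 by lra.
have N0 := psd_symabsmx A; have [hN _] := N0.
have M0 : psd (2^-1 *: (Q + P)) by apply/psd_half/psdD.
set M := 2^-1 *: (Q + P) in M0 *.
have pV : pisom (spectralmx (symabsmx A)).
  exact/unitary_pisom/spectral_unitarymx.
set V := spectralmx (symabsmx A) in pV.
have HM x := dominates_hform x dA.
have KM x := dominates_hform x (dominates_imag dA).
have := herm_sqr_tpow_le p2 pV (herm_part_adj A) M0 HM.
have := herm_sqr_tpow_le p2 pV (herm_part_adj (- 'i *: A)) M0 KM.
rewrite -/(imag_part A); set H := herm_part A; set K := imag_part A => KT HT.
have sq_ge0 (X : 'M[R[i]]_n) x : X^t* = X -> 0 <= hform (X *m X) x.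
  by move=> hX; rewrite -{1}hX; case: (psd_gram X).
rewrite tpow_eigs //.
apply: (@le_trans _ _ (\sum_j 2 `^ (p / 2) *
    (2^-1 * (hform (H *m H) (row j V) `^ (p / 2)
             + hform (K *m K) (row j V) `^ (p / 2))))).
  apply: ler_sum => j _.
  have -> : eigs (symabsmx A) 0 j `^ p
      = (eigs (symabsmx A) 0 j ^+ 2) `^ (p / 2).
    by rewrite -powR_mulrn ?eigs_ge0 // -powRrM; congr (_ `^ _); field.
  rewrite -hform_sqr_eig // -/V.
  have Hj : 0 <= hform (H *m H) (row j V) by apply/sq_ge0/herm_part_adj.
  have Kj : 0 <= hform (K *m K) (row j V) by apply/sq_ge0/herm_part_adj.
  apply: le_trans (powR_add_le p1 Hj Kj).
  apply: ge0_ler_powR; last exact: hform_symabsmx_sqr.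
  - exact: (le_trans ler01 p1).
  - rewrite nnegrE; exact: sq_ge0 hN.
  - rewrite nnegrE; exact: (addr_ge0 Hj Kj).
rewrite -mulr_sumr; apply: ler_wpM2l; first exact: powR_ge0.
rewrite -mulr_sumr big_split.
exact: half_add_le HT KT.
Qed.

(** * The operator norm *)

Lemma opnorm_psd (R : realType) (n : nat) (X : 'M[R[i]]_n) : psd X ->
  opnorm X = \big[Num.max/0]_(j < n) eigs X 0 j.
Proof.
by move=> X0; rewrite /opnorm absmx_psd //; apply: eq_bigr => j _; rewrite mxE.
Qed.

Lemma eigs_le_opnorm (R : realType) (n : nat) (X : 'M[R[i]]_n) j : psd X ->
  eigs X 0 j <= opnorm X.
Proof. by move=> X0; rewrite opnorm_psd //; apply: le_bigmax. Qed.

Lemma opnorm_ge0 (R : realType) (n : nat) (X : 'M[R[i]]_n) : 0 <= opnorm X.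
Proof. by rewrite /opnorm; apply: bigmax_ge_id. Qed.

Lemma opnorm_le (R : realType) (n : nat) (X : 'M[R[i]]_n) (c : R) :
  psd X -> 0 <= c -> (forall j, eigs X 0 j <= c) -> opnorm X <= c.
Proof. by move=> X0 c0 Xc; rewrite opnorm_psd //; apply: bigmax_le. Qed.

Lemma sum_normsq_unitary (R : realType) (n : nat) (V : 'M[R[i]]_n)
    (x : 'rV[R[i]]_n) :
  V \is unitarymx ->
  \sum_j normsq ((x *m V^t*) 0 j) = \sum_j normsq (x 0 j).
Proof.
move=> uV; apply: (@complexI R); rewrite -!mulmx_adj_diag.
by rewrite adjM trmxCK mulmxA (mulmxKtV _ uV erefl).
Qed.

Lemma hform_le_opnorm (R : realType) (n : nat) (X : 'M[R[i]]_n) x : psd X ->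
  hform X x <= opnorm X * \sum_j normsq (x 0 j).
Proof.
move=> X0; have [hX _] := X0; rewrite {1}(herm_spectral hX) hform_rdiag.
rewrite -(sum_normsq_unitary x (spectral_unitarymx X)) mulr_sumr.
apply: ler_sum => j _; rewrite mulrC; apply: ler_wpM2r; first exact: normsq_ge0.
exact: eigs_le_opnorm.
Qed.

Lemma sum_normsq_row (R : realType) (n : nat) (V : 'M[R[i]]_n) j :
  V \is unitarymx -> \sum_k normsq (row j V 0 k) = 1.
Proof.
move=> /unitarymxP uV; apply: (@complexI R).
have <- : 1%:M j j = 1%:C :> R[i] by rewrite mxE eqxx.
rewrite -uV mulmx_adj_diag; congr _%:C.
by apply: eq_bigr => k _; rewrite mxE.
Qed.

Lemma herm_sqr_opnorm_le (R : realType) (n : nat) (H M : 'M[R[i]]_n) x :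
  H^t* = H -> psd M -> (forall y, `|hform H y| <= hform M y) ->
  hform (H *m H) x <= opnorm M ^+ 2 * \sum_j normsq (x 0 j).
Proof.
move=> hH M0 HM; have uV := spectral_unitarymx H.
rewrite hform_sqr // -(sum_normsq_unitary x uV) mulr_sumr.
apply: ler_sum => j _; rewrite mulrC; apply: ler_wpM2r; first exact: normsq_ge0.
rewrite -[_ ^+ 2]real_normK ?num_real // lerXn2r ?nnegrE ?opnorm_ge0 //.
rewrite eigsE //; apply: le_trans (HM _) _.
have := hform_le_opnorm (row j (spectralmx H)) M0.
by rewrite sum_normsq_row // mulr1.
Qed.

Lemma opnorm_symabsmx_le (R : realType) (n : nat) (A Q P : 'M[R[i]]_n) :
  psd Q -> psd P -> dominates A Q P ->
  opnorm (symabsmx A) <= Num.sqrt 2 * opnorm (2^-1 *: (Q + P)).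
Proof.
move=> Q0 P0 dA.
have N0 := psd_symabsmx A; have [hN _] := N0.
have M0 : psd (2^-1 *: (Q + P)) by apply/psd_half/psdD.
set M := 2^-1 *: (Q + P) in M0 *.
have c0 : 0 <= Num.sqrt 2 * opnorm M by rewrite mulr_ge0 ?sqrtr_ge0 ?opnorm_ge0.
apply: opnorm_le => // j.
rewrite -(@ler_pXn2r _ 2) ?nnegrE ?eigs_ge0 // exprMn sqr_sqrtr //.
rewrite -hform_sqr_eig //; apply: le_trans (hform_symabsmx_sqr _ _) _.
have HM x := dominates_hform x dA.
have KM x := dominates_hform x (dominates_imag dA).
set x := row j _.
have Hx := herm_sqr_opnorm_le x (herm_part_adj A) M0 HM.
have Kx := herm_sqr_opnorm_le x (herm_part_adj (- 'i *: A)) M0 KM.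
rewrite mulr_natl mulr2n.
have x1 : \sum_k normsq (x 0 k) = 1.
  exact/sum_normsq_row/spectral_unitarymx.
rewrite x1 mulr1 in Hx; rewrite x1 mulr1 in Kx.
exact: lerD Hx Kx.
Qed.

(** * Upper bounds on the constant *)

Lemma schatten_psd (R : realType) (n : nat) (p : R) (X : 'M[R[i]]_n) : psd X ->
  schatten_norm p%:E X = tpow p X `^ p^-1.
Proof. by move=> X0; rewrite /schatten_norm absmx_psd. Qed.

Lemma schatten_ge0 (R : realType) (n : nat) (p : \bar R) (X : 'M[R[i]]_n) :
  0 <= schatten_norm p X.
Proof. by case: p => [p||] //=; [apply: powR_ge0 | apply: opnorm_ge0]. Qed.

Lemma schatten_le (R : realType) (n : nat) (p e : R) (X Y : 'M[R[i]]_n) :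
  0 < p -> psd X -> psd Y -> tpow p X <= 2 `^ e * tpow p Y ->
  schatten_norm p%:E X <= 2 `^ (e / p) * schatten_norm p%:E Y.
Proof.
move=> p0 X0 Y0 XY; rewrite !schatten_psd // powRrM.
rewrite -powRM ?powR_ge0 ?tpow_ge0 //.
apply: ge0_ler_powR => //; first by rewrite invr_ge0 ltW.
  by rewrite nnegrE tpow_ge0.
by rewrite nnegrE mulr_ge0 ?powR_ge0 ?tpow_ge0.
Qed.

Lemma sum_symabsmx (R : realType) (m n : nat) (A : 'I_m -> 'M[R[i]]_n) :
  \sum_k symabsmx (A k)
  = 2^-1 *: (\sum_k absmx ((A k)^t*) + \sum_k absmx (A k)).
Proof.
rewrite -big_split scaler_sumr; apply: eq_bigr => k _.
by rewrite /symabsmx addrC.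
Qed.

Lemma dominates_sum_absmx (R : realType) (m n : nat) (A : 'I_m -> 'M[R[i]]_n) :
  dominates (\sum_k A k) (\sum_k absmx ((A k)^t*)) (\sum_k absmx (A k)).
Proof. by apply: dominates_sum => k; apply: dominates_absmx. Qed.

Lemma psd_sum_symabsmx (R : realType) (m n : nat) (A : 'I_m -> 'M[R[i]]_n) :
  psd (\sum_k symabsmx (A k)).
Proof. by apply: psd_sum => k; apply: psd_symabsmx. Qed.

Lemma psd_sum_absmx (R : realType) (m n : nat) (A : 'I_m -> 'M[R[i]]_n) :
  psd (\sum_k absmx (A k)).
Proof. by apply: psd_sum => k; apply: psd_absmx. Qed.

Lemma sym_bound_pow (R : realType) (m n : nat) (p : R) : 1 <= p ->
  sym_bound p%:E m n (2 `^ (1 - p^-1)).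
Proof.
move=> p1 A; have p0 : 0 < p := lt_le_trans ltr01 p1.
have -> : 1 - p^-1 = (p - 1) / p by rewrite mulrBl divff ?gt_eqF // mul1r.
apply: schatten_le => //; [exact: psd_symabsmx | exact: psd_sum_symabsmx |].
rewrite sum_symabsmx; apply: tpow_symabsmx_le => //;
  [| |exact: dominates_sum_absmx]; exact: psd_sum_absmx.
Qed.

Lemma sym_bound_sqrt2_ge2 (R : realType) (m n : nat) (p : R) : 2 <= p ->
  sym_bound p%:E m n (Num.sqrt 2).
Proof.
move=> p2 A; have p0 : 0 < p by apply: lt_le_trans p2.
have -> : Num.sqrt 2 = 2 `^ (p / 2 / p) :> R.
  by rewrite mulrAC divff ?gt_eqF // mul1r powR12_sqrt.
apply: schatten_le => //; [exact: psd_symabsmx | exact: psd_sum_symabsmx |].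
rewrite sum_symabsmx; apply: tpow_symabsmx_le_ge2 => //;
  [| |exact: dominates_sum_absmx]; exact: psd_sum_absmx.
Qed.

Lemma sym_bound_le (R : realType) (m n : nat) (p : \bar R) (c d : R) : c <= d ->
  sym_bound p m n c -> sym_bound p m n d.
Proof.
move=> cd pc A; apply: le_trans (pc A) _.
by apply: ler_wpM2r => //; apply: schatten_ge0.
Qed.

Lemma sqrt2_pow (R : realType) : Num.sqrt 2 = 2 `^ 2^-1 :> R.
Proof. by rewrite powR12_sqrt. Qed.

(** Below p = 2 the constant 2^(1 - 1/p) is at most sqrt 2. *)
Lemma sym_bound_sqrt2 (R : realType) (m n : nat) (p : \bar R) : (1 <= p)%E ->
  sym_bound p m n (Num.sqrt 2).
Proof.
case: p => [p||] //; rewrite ?lee_fin => p1.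
  have [p2|/ltW p2] := leP 2 p; first exact: sym_bound_sqrt2_ge2.
  apply: sym_bound_le (sym_bound_pow p1); rewrite sqrt2_pow.
  apply: ler_powR; first by rewrite ler1n.
  have : 2^-1 <= p^-1 by rewrite lef_pV2 // posrE; lra.
  lra.
move=> A; rewrite /schatten_norm sum_symabsmx.
by apply: opnorm_symabsmx_le; [| |exact: dominates_sum_absmx];
   apply: psd_sum_absmx.
Qed.

(** * Diagonal matrices and rank-one matrices *)

Lemma rdiag_conj1 (R : realType) (n : nat) (d : 'rV[R]_n) :
  rdiag d = 1%:M^t* *m rdiag d *m 1%:M.
Proof. by rewrite trmx1 map_mx1 mul1mx mulmx1. Qed.

Lemma unitarymx1 (R : realType) (n : nat) : (1%:M : 'M[R[i]]_n) \is unitarymx.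
Proof. by apply/unitarymxP; rewrite trmx1 map_mx1 mulmx1. Qed.

Lemma psd_rdiag1 (R : realType) (n : nat) (d : 'rV[R]_n) :
  (forall j, 0 <= d 0 j) -> psd (rdiag d).
Proof. by move=> d0; rewrite rdiag_conj1; apply: psd_rdiag. Qed.

Lemma tpow_rdiag (R : realType) (n : nat) (p : R) (d : 'rV[R]_n) :
  tpow p (rdiag d) = \sum_j d 0 j `^ p.
Proof. by rewrite rdiag_conj1 tpow_conj // unitarymx1. Qed.

Lemma hform_rdiag1 (R : realType) (n : nat) (d : 'rV[R]_n) x :
  hform (rdiag d) x = \sum_j normsq (x 0 j) * d 0 j.
Proof. by rewrite rdiag_conj1 hform_rdiag trmx1 map_mx1 mulmx1. Qed.

Lemma le_opnorm_rdiag (R : realType) (n : nat) (d : 'rV[R]_n) j :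
  (forall j, 0 <= d 0 j) -> d 0 j <= opnorm (rdiag d).
Proof.
move=> d0; have := hform_le_opnorm (row j 1%:M) (psd_rdiag1 d0).
rewrite hform_rdiag1 sum_normsq_row ?unitarymx1 // mulr1; apply: le_trans.
rewrite (bigD1 j) //= big1.
  by rewrite /normsq !mxE eqxx /= expr1n expr0n !addr0 mul1r.
by move=> k /negPf kj; rewrite /normsq !mxE eq_sym kj /= expr0n addr0 mul0r.
Qed.

Lemma opnorm_rdiag_le (R : realType) (n : nat) (d : 'rV[R]_n) (c : R) :
  0 <= c -> (forall j, 0 <= d 0 j <= c) -> opnorm (rdiag d) <= c.
Proof.
move=> c0 dc.
have D0 : psd (rdiag d) by apply: psd_rdiag1 => j; case/andP: (dc j).
apply: opnorm_le => // j; rewrite eigsE; last by case: D0.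
rewrite hform_rdiag1 -[leRHS]mulr1.
rewrite -(sum_normsq_row j (spectral_unitarymx (rdiag d))) mulr_sumr.
apply: ler_sum => k _; rewrite mulrC; apply: ler_wpM2r; first exact: normsq_ge0.
by case/andP: (dc k).
Qed.

Lemma symabsmx_psd (R : realType) (n : nat) (X : 'M[R[i]]_n) : psd X ->
  symabsmx X = X.
Proof.
move=> X0; have [hX _] := X0; rewrite /symabsmx hX absmx_psd //.
rewrite -[X + X]mulr2n -[X *+ 2]scaler_nat scalerA.
by rewrite mulVf ?scale1r // pnatr_eq0.
Qed.

Lemma symabsmx0 (R : realType) (n : nat) : symabsmx (0 : 'M[R[i]]_n) = 0.
Proof.
apply: symabsmx_psd; split; first by rewrite trmx0 map_mx0.
by move=> x; rewrite /hform mulmx0 mul0mx mxE.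
Qed.

(** When a and b have the same norm, |c| b^* b and |c| a^* a square to Z^* Z and
    Z Z^* for Z = c a^* b. *)
Lemma symabsmx_rank1 (R : realType) (n : nat) (t c : R) (a b : 'rV[R[i]]_n) :
  a *m a^t* = (t%:C)%:M -> b *m b^t* = (t%:C)%:M ->
  symabsmx (c%:C *: (a^t* *m b)) = (`|c| / 2)%:C *: (a^t* *m a + b^t* *m b).
Proof.
have cC : Num.conj c%:C = c%:C by apply: conjc_real.
have abs_rank1 (x y : 'rV[R[i]]_n) :
  x *m x^t* = (t%:C)%:M -> y *m y^t* = (t%:C)%:M ->
  absmx (c%:C *: (x^t* *m y)) = `|c|%:C *: (y^t* *m y).
  move=> xx yy; apply: absmx_unique.
    by apply: psdZ => //; apply: psd_gram.
  have c2 : `|c| * `|c| = c * c by rewrite -!expr2 real_normK ?num_real.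
  rewrite adjZ adjM trmxCK cC !mulmxZZ -!rmorphM c2; congr (_ *: _).
  rewrite -[LHS]mulmxA [y *m (_ *m _)]mulmxA yy.
  by rewrite -[RHS]mulmxA [x *m (_ *m _)]mulmxA xx.
move=> aa bb; rewrite /symabsmx abs_rank1 // adjZ adjM trmxCK cC abs_rank1 //.
rewrite addrC -scalerDr scalerA; congr (_ *: _).
by rewrite half_RC -rmorphM mulrC.
Qed.

(** * Lower bounds on the constant *)

Lemma sum_two (R : realType) (m n : nat) (f : 'M[R[i]]_n -> 'M[R[i]]_n)
    (X Y : 'M[R[i]]_n) (k0 k1 : 'I_m) : k0 != k1 -> f 0 = 0 ->
  \sum_k f (if k == k0 then X else if k == k1 then Y else 0) = f X + f Y.
Proof.
move=> k01 f0; have k10 : k1 != k0 by rewrite eq_sym.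
rewrite (bigD1 k0) //= eqxx (bigD1 k1) //= (negPf k10) eqxx big1 ?addr0 //.
by move=> k /andP[/negPf -> /negPf ->].
Qed.

(** Families with at most two nonzero members suffice for all lower bounds. *)
Lemma sym_bound_two (R : realType) (m n : nat) (p : \bar R) (c : R)
    (X Y : 'M[R[i]]_n) : (2 <= m)%N -> sym_bound p m n c ->
  schatten_norm p (symabsmx (X + Y))
  <= c * schatten_norm p (symabsmx X + symabsmx Y).
Proof.
move=> m2 pc; pose k0 : 'I_m := Ordinal (ltnW m2); pose k1 : 'I_m := Ordinal m2.
have k01 : k0 != k1 by [].
pose A k := if k == k0 then X else if k == k1 then Y else 0.
have S1 : \sum_k A k = X + Y by apply: (sum_two (f := id)).
have S2 : \sum_k symabsmx (A k) = symabsmx X + symabsmx Y.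
  by apply: sum_two => //; apply: symabsmx0.
by have := pc A; rewrite S1 S2.
Qed.

(** Test on a family whose only nonzero member is the identity. *)
Lemma sym_bound_ge1 (R : realType) (m n : nat) (p : \bar R) (c : R) :
  (2 <= m)%N -> (0 < n)%N -> (1 <= p)%E -> sym_bound p m n c -> 1 <= c.
Proof.
move=> m2 n0 p1 /(sym_bound_two 1%:M 0 m2).
rewrite addr0 symabsmx0 addr0.
have d0 j : 0 <= (const_mx 1 : 'rV[R]_n) 0 j by rewrite mxE.
have E1 : 1%:M = rdiag (const_mx 1) :> 'M[R[i]]_n.
  by rewrite /rdiag map_const_mx diag_const_mx.
have psd1 : psd (1%:M : 'M[R[i]]_n) by rewrite E1; apply: psd_rdiag1.
rewrite symabsmx_psd //; suff s0 : 0 < schatten_norm p (1%:M : 'M[R[i]]_n).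
  by rewrite -{1}[schatten_norm _ _]mul1r ler_pM2r.
case: p p1 => [p||] // p1; last first.
  rewrite /schatten_norm E1.
  apply: lt_le_trans (le_opnorm_rdiag (Ordinal n0) d0).
  by rewrite mxE.
rewrite schatten_psd // powR_gt0 // E1 tpow_rdiag.
under eq_bigr do rewrite mxE powR1.
by rewrite sumr_const card_ord ltr0n.
Qed.

(** The constraints on c have the form a <= c * b with b >= 0, so that they pass
    to the infimum. *)
Lemma csym_smallest (R : realType) (m n : nat) (p : \bar R) :
  (2 <= m)%N -> (0 < n)%N -> (1 <= p)%E ->
  sym_bound p m n (csym p m n) /\
  (forall c : R, sym_bound p m n c -> csym p m n <= c).
Proof.
move=> m2 n0 p1.
have lb : has_lbound [set c : R | sym_bound p m n c].
  by exists 1 => c /=; apply: sym_bound_ge1.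
have ne : [set c : R | sym_bound p m n c] !=set0.
  by exists (Num.sqrt 2); apply: sym_bound_sqrt2.
split; last by move=> c pc; apply: ge_inf.
move=> A; have Ac c := (fun h : sym_bound p m n c => h A).
have := schatten_ge0 p (\sum_k symabsmx (A k)).
have := Ac _ (@sym_bound_sqrt2 R m n p p1).
move: (schatten_norm _ _) (schatten_norm _ _) Ac => a b Ac ab.
rewrite le_eqVlt => /predU1P[b0|b0]; first by rewrite -b0 !mulr0 in ab *.
rewrite -ler_pdivrMr //; apply: lb_le_inf => // c pc.
by rewrite ler_pdivrMr //; apply: Ac.
Qed.

Lemma csym_ge (R : realType) (m n : nat) (p : \bar R) (c : R) :
  (1 <= p)%E -> (forall d, sym_bound p m n d -> c <= d) -> c <= csym p m n.
Proof.
move=> p1 pc; apply: lb_le_inf => //.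
by exists (Num.sqrt 2); apply: sym_bound_sqrt2.
Qed.

Lemma rdiagD (R : realType) (n : nat) (d e : 'rV[R]_n) :
  rdiag (d + e) = rdiag d + rdiag e.
Proof. by rewrite /rdiag map_mxD raddfD. Qed.

Lemma rdiagZ (R : realType) (n : nat) (a : R) (d : 'rV[R]_n) :
  rdiag (a *: d) = a%:C *: rdiag d.
Proof. by rewrite /rdiag map_mxZ linearZ. Qed.

Lemma rdiag_delta (R : realType) (n : nat) (j : 'I_n) :
  rdiag (delta_mx 0 j : 'rV[R]_n) = delta_mx j j.
Proof.
apply/matrixP => i k; rewrite !mxE /=.
have [->|ik] := eqVneq i k; first by rewrite mulr1n rmorph_nat andbb.
rewrite mulr0n; case: eqP => // ij; case: eqP => // kj.
by rewrite ij kj eqxx in ik.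
Qed.

(** A pair of rank-one matrices for which the sum of the symmetric moduli is
    diag(1, 1, 1), while the symmetric modulus of the sum is
    diag(sqrt 2, 1 / sqrt 2, 1 / sqrt 2): the latter is the mean of the moduli
    of sqrt 2 (E_01 + E_20) and of its adjoint, which share the vector e_0. *)
Lemma extremal_pair (R : realType) (n : nat) (i0 i1 i2 : 'I_n)
    (r := Num.sqrt 2 : R) :
  i0 != i1 -> i0 != i2 -> i1 != i2 ->
  exists X Y : 'M[R[i]]_n,
  symabsmx X + symabsmx Y
    = rdiag (delta_mx 0 i0 + delta_mx 0 i1 + delta_mx 0 i2) /\
  symabsmx (X + Y)
    = rdiag (r *: delta_mx 0 i0 + (r / 2) *: (delta_mx 0 i1 + delta_mx 0 i2)).
Proof.
move=> n01 n02 n12; pose e (i : 'I_n) : 'rV[R[i]]_n := delta_mx 0 i.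
have r0 : 0 <= r by apply: sqrtr_ge0.
have rr : r%:C * r%:C = 2 by rewrite -rmorphM -expr2 sqr_sqrtr // rmorph_nat.
have ee i j : (e i)^t* *m e j = delta_mx i j.
  by rewrite /e trmx_delta map_delta_mx mul_delta_mx.
have ee' i j : e i *m (e j)^t* = ((i == j)%:R)%:M.
  rewrite /e trmx_delta map_delta_mx mul_delta_mx_cond.
  by case: (i == j); apply/matrixP => k l; rewrite ?mulr0n ?mulr1n !ord1 !mxE.
clearbody e; have rC : Num.conj r%:C = r%:C by apply: conjc_real.
have nrC : Num.conj (- r%:C) = - r%:C by rewrite rmorphN /= rC.
have nrr : - r%:C * - r%:C = 2 by rewrite mulrNN.
(* In X, Y = +-(e_0 +- r e_2)^* (e_0 +- r e_1) / 2 the terms of even degree in r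
   cancel from X + Y, and those of odd degree from the sum of the moduli. *)
pose w (q : R[i]) i := e i0 + q *: e i.
have ww (q : R[i]) i : Num.conj q = q -> q * q = 2 -> i0 != i ->
    w q i *m (w q i)^t* = (3%:C)%:M.
  move=> qC qq ni; rewrite /w adjD adjZ qC mulmxDl !mulmxDr mulmxZZ qq.
  rewrite -!scalemxAl -!scalemxAr !ee' !eqxx [i == i0]eq_sym (negPf ni).
  apply/matrixP => k l; rewrite !ord1 !mxE eqxx !mulr1n rmorph_nat /=; ring.
have wg (q : R[i]) i j : Num.conj q = q -> q * q = 2 ->
    (w q i)^t* *m w q j = delta_mx i0 i0 + q *: delta_mx i0 j
                          + q *: delta_mx i i0 + 2 *: delta_mx i j.
  move=> qC qq; rewrite /w adjD adjZ qC mulmxDl !mulmxDr mulmxZZ qq.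
  by rewrite -!scalemxAl -!scalemxAr !ee !addrA.
have absE (a b c d : 'I_n) : a != c -> b != d ->
    absmx (r%:C *: (delta_mx a b + delta_mx c d))
    = r%:C *: (delta_mx b b + delta_mx d d).
  move=> ac bd; apply: absmx_unique.
    rewrite -!rdiag_delta -rdiagD -rdiagZ; apply: psd_rdiag1 => j.
    by rewrite !mxE mulr_ge0.
  rewrite adjZ adjD rC !mulmxZZ; congr (_ *: _).
  rewrite !trmx_delta !map_delta_mx !mulmxDl !mulmxDr !mul_delta_mx_cond.
  by rewrite !eqxx [d == b]eq_sym [c == a]eq_sym (negPf ac) (negPf bd).
clearbody w.
exists (2^-1%:C *: ((w r%:C i2)^t* *m w r%:C i1)),
  ((- 2^-1)%:C *: ((w (- r%:C) i2)^t* *m w (- r%:C) i1)).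
split.
  rewrite !(@symabsmx_rank1 _ _ 3) ?ww // !wg // normrN gtr0_norm ?invr_gt0 //.
  rewrite !rdiagD !rdiag_delta rmorphM /= -half_RC.
  move: (delta_mx i0 i0) (delta_mx i0 i1) (delta_mx i0 i2) (delta_mx i1 i0).
  move: (delta_mx i2 i0) (delta_mx i1 i1) (delta_mx i2 i2) => a b c d f g h.
  move: r%:C => q; apply/matrixP => i j; rewrite !mxE.
  move: (a i j) (b i j) (c i j) (d i j) (f i j) (g i j) (h i j) => *.
  by field.
have -> : 2^-1%:C *: ((w r%:C i2)^t* *m w r%:C i1) +
    (- 2^-1)%:C *: ((w (- r%:C) i2)^t* *m w (- r%:C) i1)
  = r%:C *: (delta_mx i0 i1 + delta_mx i2 i0).
  rewrite !wg // rmorphN /= -half_RC.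
  move: (delta_mx i0 i0) (delta_mx i0 i1) (delta_mx i2 i0) (delta_mx i2 i1).
  move: r%:C => q a b c d; apply/matrixP => i j; rewrite !mxE.
  by move: (a i j) (b i j) (c i j) (d i j) => *; field.
rewrite /symabsmx absE // 1?eq_sym // adjZ rC adjD !trmx_delta !map_delta_mx.
rewrite absE // 1?eq_sym //.
rewrite !rdiagD !rdiagZ !rdiagD !rdiag_delta rmorphM /= -half_RC.
move: (delta_mx i0 i0) (delta_mx i1 i1) (delta_mx i2 i2) r%:C => a b c q.
apply/matrixP => i j; rewrite !mxE.
by move: (a i j) (b i j) (c i j) => *; field.
Qed.

(** * The lower bound as a function of p *)

(** With y = x e^u and u <> 0, add e^((t - 1) u) > 1 + (t - 1) u to t - 1 times
    e^(- u) > 1 - u. *)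
Lemma powR_tangent_lt (R : realType) (t x y : R) : 1 < t -> 0 < x -> 0 < y ->
  x != y -> t * x `^ (t - 1) * y < (t - 1) * x `^ t + y `^ t.
Proof.
move=> t1 x0 y0 xy; pose u := ln (y / x).
have z0 : 0 < y / x by rewrite divr_gt0.
have eu : expR u = y / x by rewrite lnK // posrE.
have u0 : u != 0.
  apply: contra xy => /eqP u0; apply/eqP; rewrite -[RHS](@divfK _ x) ?gt_eqF //.
  by rewrite -eu u0 expR0 mul1r.
have yE : y = x * expR u by rewrite eu mulrC divfK ?gt_eqF.
have -> : t * x `^ (t - 1) * y = x `^ t * (t * expR u).
  by rewrite yE -(@mulr_powRB1 R x t) //; [ring | exact: ltW | lra].
have -> : y `^ t = x `^ t * expR (t * u).
  by rewrite yE powRM ?expR_ge0 ?ltW // mulrC [t * u]mulrC expRM mulrC.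
rewrite [(t - 1) * _]mulrC -mulrDr ltr_pM2l ?powR_gt0 //.
have h1 : 1 - u < expR (- u) by apply: expR_gt1Dx; rewrite oppr_eq0.
have h2 : 1 + (t - 1) * u < expR ((t - 1) * u).
  by apply: expR_gt1Dx; rewrite mulf_neq0 //; lra.
have h3 : t < (t - 1) * expR (- u) + expR ((t - 1) * u).
  have : (t - 1) * (1 - u) < (t - 1) * expR (- u) by rewrite ltr_pM2l //; lra.
  lra.
have -> : t - 1 + expR (t * u)
    = ((t - 1) * expR (- u) + expR ((t - 1) * u)) * expR u.
  rewrite mulrDl -mulrA -!expRD addNr expR0 mulr1; congr (_ + expR _); ring.
by rewrite ltr_pM2r ?expR_gt0.
Qed.

Lemma pow2_half (R : realType) (p : R) :
  2 `^ (1 - p / 2) = 2 / 2 `^ (p / 2) :> R.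
Proof.
by rewrite powRB ?powRr1 //; apply/implyP => _; rewrite pnatr_eq0.
Qed.

(** With x = 2^(p/2) in [1, 2], the claim x + 2/x <= 3 reads
    (x - 1) (x - 2) <= 0. *)
Lemma csym_lower_le1 (R : realType) (p : R) : 1 <= p -> p <= 2 ->
  csym_lower p%:E <= 1.
Proof.
move=> p1 p2; rewrite /csym_lower pow2_half; set x := 2 `^ (p / 2).
have x1 : 1 <= x by rewrite -[leLHS](powRr0 2) ler_powR ?ler1n //; lra.
have x2 : x <= 2.
  by rewrite -[leRHS](@powRr1 R 2) // ler_powR ?ler1n //; lra.
rewrite [leRHS](_ : 1 = 1 `^ p^-1); last by rewrite powR1.
have x0 : 0 < x by lra.
have B1 : (x + 2 / x) / 3 <= 1.
  rewrite ler_pdivrMr // mul1r -(ler_pM2r x0) mulrDl divfK ?gt_eqF //; nra.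
apply: ge0_ler_powR B1; first by rewrite invr_ge0; lra.
  by rewrite nnegrE divr_ge0 // addr_ge0 ?divr_ge0 // ltW.
by rewrite nnegrE.
Qed.

Lemma csym_lower2 (R : realType) : csym_lower (2%:E : \bar R) = 1.
Proof.
rewrite /csym_lower divff ?pnatr_eq0 // subrr powRr0 powRr1 //.
have -> : (2 + 1) / 3 = 1 :> R by field.
by rewrite powR1.
Qed.

(** csym_lower p is the L^p norm of a nonconstant function on a probability
    space with atoms of mass 1/3 and 2/3, hence increases strictly with p. *)
Lemma csym_lower_lt (R : realType) (p q : R) : 2 <= p -> p < q ->
  csym_lower p%:E < csym_lower q%:E.
Proof.
move=> p2 pq; rewrite /csym_lower.
have p0 : 0 < p by lra.
have q0 : 0 < q by lra.
pose t := q / p; have t1 : 1 < t by rewrite ltr_pdivlMr // mul1r.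
have qE : q = p * t by rewrite /t mulrC divfK ?gt_eqF.
have split2 s : (2 `^ (s / 2) + 2 `^ (1 - s / 2)) / 3
    = (2 `^ (s / 2) + 2 * 2 `^ (- (s / 2))) / 3 :> R.
  by rewrite pow2_half powRN.
rewrite !split2.
have -> : 2 `^ (q / 2) = (2 `^ (p / 2)) `^ t :> R.
  by rewrite -powRrM qE; congr (_ `^ _); ring.
have -> : 2 `^ (- (q / 2)) = (2 `^ (- (p / 2))) `^ t :> R.
  by rewrite -powRrM qE; congr (_ `^ _); ring.
set a := 2 `^ (p / 2); set b := 2 `^ (- (p / 2)).
have b0 : 0 < b by apply: powR_gt0.
have ab : b < a.
  rewrite /a /b -ltr_ln ?posrE ?powR_gt0 // !ln_powR ltr_pM2r ?ln_gt0 ?ltr1n //.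
  lra.
set m := (a + 2 * b) / 3; have m0 : 0 < m by rewrite divr_gt0 // /m; lra.
have ma : m != a by apply/negP => /eqP; rewrite /m; lra.
have -> : m `^ p^-1 = (m `^ t) `^ q^-1.
  by rewrite -powRrM /t; congr (_ `^ _); field; rewrite !gt_eqF.
apply: gt0_ltr_powR; rewrite ?invr_gt0 ?nnegrE ?powR_ge0 //.
  by rewrite divr_ge0 // addr_ge0 ?mulr_ge0 ?powR_ge0.
have a0 : 0 < a by lra.
have ha := powR_tangent_lt t1 m0 a0 ma.
have hb := powR_tangent (ltW t1) (ltW m0) (ltW b0).
have mm : t * m `^ (t - 1) * m = t * m `^ t.
  rewrite -mulrA; congr (_ * _).
  by rewrite mulrC mulr_powRB1 ?(ltW m0) ?(lt_trans ltr01 t1).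
have := mm; rewrite {2}/m.
rewrite ltr_pdivlMr //.
move: ha hb; move: (t * m `^ (t - 1)) (m `^ t) (a `^ t) (b `^ t) => k M x y.
lra.
Qed.

(** Squeezed between 3^(-1/p) sqrt 2 and sqrt 2. *)
Lemma csym_lower_cvg (R : realType) :
  csym_lower p%:E @[p --> +oo] --> (Num.sqrt 2 : R).
Proof.
have V0 : p^-1 @[p --> +oo] --> (0 : R).
  by apply/gtr0_cvgV0; [apply: nbhs_pinfty_gt | apply: cvg_id].
have lb : Num.sqrt 2 * expR (ln (3^-1) * p^-1) @[p --> +oo]
    --> (Num.sqrt 2 : R).
  have lim0 : Num.sqrt 2 * expR (ln 3^-1 * 0) = Num.sqrt 2 :> R.
    by rewrite mulr0 expR0 mulr1.
  rewrite -[X in _ --> X]lim0.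
  apply: cvgMl_tmp; apply: continuous_cvg; first exact: continuous_expR.
  exact: (cvgMl_tmp V0).
apply: (squeeze_cvgr _ lb (cvg_cst _)); near=> p.
have p1 : 1 <= p by near: p; apply: nbhs_pinfty_ge.
have p0 : 0 < p by lra.
have pV0 : 0 <= p^-1 by rewrite invr_ge0 ltW.
rewrite /csym_lower pow2_half; set x := 2 `^ (p / 2).
have x1 : 1 <= x by rewrite -[leLHS](powRr0 2) ler_powR ?ler1n //; lra.
have x0 : 0 < x by lra.
have xV : 0 < x^-1 by rewrite invr_gt0.
have xV1 : x^-1 <= 1 by rewrite invf_le1.
have -> : Num.sqrt 2 = x `^ p^-1.
  rewrite -powR12_sqrt // -powRrM; congr (_ `^ _).
  by rewrite mulrAC divff ?gt_eqF // mul1r.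
have -> : expR (ln 3^-1 * p^-1) = (3^-1) `^ p^-1.
  by rewrite expRM lnK // posrE invr_gt0.
have xp := ltW x0; have xVp := ltW xV.
rewrite -powRM // ?invr_ge0 //; apply/andP; split;
  apply: ge0_ler_powR => //; rewrite ?nnegrE; lra.
Unshelve. all: by end_near.
Qed.

(** * Comparison of the constant with the lower bound *)

Lemma sum_three (R : realType) (n : nat) (F : 'I_n -> R) (i0 i1 i2 : 'I_n) :
  i0 != i1 -> i0 != i2 -> i1 != i2 ->
  (forall j, j != i0 -> j != i1 -> j != i2 -> F j = 0) ->
  \sum_j F j = F i0 + F i1 + F i2.
Proof.
move=> n01 n02 n12 F0; rewrite (bigD1 i0) //= (bigD1 i1) 1?eq_sym //=.
rewrite (bigD1 i2) /=; last by rewrite ![i2 == _]eq_sym n02 n12.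
rewrite big1 ?addr0 ?addrA // => j /andP[/andP[j0 j1] j2]; exact: F0.
Qed.

Lemma csym_lower_le_csym (R : realType) (m n : nat) (p : \bar R) :
  (2 <= m)%N -> (3 <= n)%N -> (1 <= p)%E -> csym_lower p <= csym p m n.
Proof.
move=> m2 n3 p1; apply: csym_ge => // c pc.
pose i0 : 'I_n := Ordinal (ltnW (ltnW n3)).
pose i1 : 'I_n := Ordinal (ltnW n3); pose i2 : 'I_n := Ordinal n3.
have [n01 n02 n12] : [/\ i0 != i1, i0 != i2 & i1 != i2] by [].
have [X [Y [MXY NXY]]] := extremal_pair R n01 n02 n12.
have := sym_bound_two X Y m2 pc; rewrite MXY NXY.
set d := (X in _ <= c * schatten_norm p (rdiag X)).
set d' := (X in schatten_norm p (rdiag X) <= _).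
move: i0 i1 i2 n01 n02 n12 @d @d' {MXY NXY} => i0 i1 i2 n01 n02 n12 d d'.
set r : R := Num.sqrt 2 in d' *.
have r0 : 0 <= r by apply: sqrtr_ge0.
have dE j : d 0 j = (j == i0)%:R + (j == i1)%:R + (j == i2)%:R.
  by rewrite /d !mxE !eqxx.
have d'E j : d' 0 j
    = r * (j == i0)%:R + r / 2 * ((j == i1)%:R + (j == i2)%:R).
  by rewrite /d' !mxE !eqxx.
have n10 : (i1 == i0) = false by rewrite eq_sym (negPf n01).
have n20 : (i2 == i0) = false by rewrite eq_sym (negPf n02).
have n21 : (i2 == i1) = false by rewrite eq_sym (negPf n12).
have eqs := (eqxx, negPf n01, negPf n02, negPf n12, n10, n20, n21).
have d0 j : 0 <= d 0 j by rewrite dE !addr_ge0.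
have d'0 j : 0 <= d' 0 j by rewrite d'E addr_ge0 ?mulr_ge0 ?invr_ge0 ?addr_ge0.
clearbody d d'; case: p p1 {pc} => [p||] // p1; last first.
  rewrite /schatten_norm /csym_lower -/r => rc.
  have M1 : opnorm (rdiag d) <= 1.
    apply: opnorm_rdiag_le => // j; rewrite d0 dE /=.
    have [->|_] := eqVneq j i0; first by rewrite !eqs !addr0.
    by have [->|_] := eqVneq j i1; rewrite ?eqs ?add0r ?addr0 //; case: eqP.
  have N1 : r <= opnorm (rdiag d').
    by have := le_opnorm_rdiag i0 d'0; rewrite d'E !eqs addr0 mulr0 addr0 mulr1.
  have r_gt0 : 0 < r by rewrite sqrtr_gt0.
  have c0 : 0 <= c.
    have := lt_le_trans r_gt0 (le_trans N1 rc).
    rewrite leNgt => h; apply/negP => c_lt0; move: h.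
    by rewrite ltNge mulr_le0_ge0 ?opnorm_ge0 // ltW.
  apply: le_trans (le_trans N1 rc) _; rewrite -[leRHS]mulr1.
  by apply: ler_wpM2l.
have p0 : 0 < p by move: p1; rewrite lee_fin; apply: lt_le_trans.
have p_neq0 : p != 0 by rewrite gt_eqF.
rewrite !schatten_psd; try exact: psd_rdiag1.
rewrite !tpow_rdiag.
rewrite (sum_three n01 n02 n12) => [|j /negPf j0 /negPf j1 /negPf j2]; last first.
  by rewrite d'E j0 j1 j2 !addr0 !mulr0 addr0 powR0.
rewrite (sum_three n01 n02 n12) => [|j /negPf j0 /negPf j1 /negPf j2]; last first.
  by rewrite dE j0 j1 j2 !addr0 powR0.
rewrite !d'E !dE !eqs /= !(mulr0, addr0, add0r, mulr1) !powR1.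
have rp : r `^ p = 2 `^ (p / 2).
  by rewrite /r sqrt2_pow -powRrM mulrC.
have r_neq0 : r != 0 by rewrite gt_eqF // sqrtr_gt0.
have r2p : (r / 2) `^ p = (2 `^ (p / 2))^-1.
  have -> : r / 2 = r^-1.
    apply: (mulfI r_neq0); rewrite mulrA -expr2 sqr_sqrtr //.
    by rewrite !divff // pnatr_eq0.
  by rewrite -powR_inv1 // powRAC rp powR_inv1 ?powR_ge0.
rewrite rp r2p /csym_lower pow2_half; set x := 2 `^ (p / 2).
have x0 : 0 <= x by apply: powR_ge0.
have h3 : 0 < 3 :> R by [].
rewrite -addrA -mulr2n -[_ *+ 2]mulr_natl.
rewrite -[1 + 1 + 1 in leRHS](_ : 3 = _); last by ring.
move=> yc.
rewrite -(ler_pM2r (powR_gt0 p^-1 h3)) -powRM ?divfK ?pnatr_eq0 //.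
by rewrite mulr_ge0 ?invr_ge0 // addr_ge0 ?divr_ge0.
Qed.

Theorem theorem8p1 (R : realType) (m n : nat) (hm : (2 <= m)%N)
    (hn : (2 <= n)%N) :
  (* csym p m n is the smallest admissible constant *)
  (forall p : \bar R, (1 <= p)%E ->
     sym_bound p m n (csym p m n) /\
     (forall c : R, sym_bound p m n c -> csym p m n <= c)) /\
  (* (1) *)
  csym (1%:E : \bar R) m n = 1 /\
  (* (2) *)
  ((3 <= n)%N -> csym (+oo%E : \bar R) m n = Num.sqrt 2) /\
  (* (3) *)
  (forall p : \bar R, (1 <= p)%E ->
     csym p m n <= Num.min (2 `^ (1 - fine p^-1%E)) (Num.sqrt 2)) /\
  (* (4) *)
  (forall p : \bar R, (1 <= p)%E -> (3 <= n)%N \/ (p <= 2%:E)%E ->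
     csym_lower p <= csym p m n) /\
  csym_lower (2%:E : \bar R) = 1 /\
  (forall p q : R, 2 <= p -> p < q -> csym_lower p%:E < csym_lower q%:E) /\
  (csym_lower p%:E @[p --> +oo] --> (Num.sqrt 2 : R)).
Proof.
have n0 : (0 < n)%N by apply: ltnW.
have small (p : \bar R) (p1 : (1 <= p)%E) := @csym_smallest R m n p hm n0 p1.
have ge1 (p : \bar R) (p1 : (1 <= p)%E) : 1 <= csym p m n.
  by apply: (sym_bound_ge1 hm n0 p1); case: (small p p1).
have le_sqrt2 (p : \bar R) (p1 : (1 <= p)%E) : csym p m n <= Num.sqrt 2.
  by case: (small p p1) => _; apply; apply: sym_bound_sqrt2.
have le_pow (p : R) : 1 <= p -> csym p%:E m n <= 2 `^ (1 - p^-1).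
  move=> p1; have [_] := small p%:E p1; apply; exact: sym_bound_pow.
do !split.
- by case: (small p H).
- by case: (small p H).
- apply/eqP; rewrite eq_le ge1 // andbT; apply: le_trans (le_pow 1 _) _ => //.
  by rewrite invr1 subrr powRr0.
- move=> n3; apply/eqP; rewrite eq_le le_sqrt2 ?leey //=.
  by have := @csym_lower_le_csym R m n +oo%E hm n3 (leey _).
- move=> p p1; rewrite le_min le_sqrt2 // andbT.
  case: p p1 => [p||] // p1.
    have p0 : 0 < p by move: p1; rewrite lee_fin; apply: lt_le_trans.
    by rewrite inver gt_eqF //=; apply: le_pow.
  rewrite invey /= subr0 powRr1 //; apply: le_trans (le_sqrt2 _ p1) _.
  by rewrite sqrt2_pow -[leRHS](@powRr1 R 2) // ler_powR ?ler1n //; lra.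
- move=> p p1 [n3|p2]; first exact: csym_lower_le_csym.
  case: p p1 p2 => [p||] // p1 p2.
  by apply: le_trans (csym_lower_le1 p1 p2) (ge1 _ p1).
- exact: csym_lower2.
- exact: csym_lower_lt.
- exact: csym_lower_cvg.
Qed.
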